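(* Let $\mathcal{A}$ be a unital $C^*$-algebra endowed with a unital completely positive map $\sigma$, and let $\mathcal{C}\subset\mathcal{A}$ be a unital (i.e. containing the unit of $\mathcal{A}$), $\sigma$-stable, AF, commutative $C^*$-subalgebra. If $\sigma(ca)=\sigma(c)\sigma(a)$ for all $c\in\mathcal{C}$, $a\in\mathcal{A}$, then every state $\mu$ on $\mathcal{C}$ satisfying $\mu\circ\sigma=\mu$ extends to a state $\phi$ on $\mathcal{A}$ such that (1) $\phi\circ\sigma=\phi$, (2) $\phi(ca)=\phi(ac)$ for all $c\in\mathcal{C}$, $a\in\mathcal{A}$. In particular, if $\mu$ is faithful, then for every finite-dimensional $C^*$-subalgebra $M\subset\mathcal{C}$ containing the unit of $\mathcal{A}$ there exists a unique conditional expectation $E_M:\mathcal{A}\to M$ such that $\phi\circ E_M=\phi$.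
   Context: $\sigma$-stable means $\sigma(\mathcal{C})\subset\mathcal{C}$. AF means that $\mathcal{C}$ is the closure of the union of an increasing sequence of finite-dimensional $C^*$-subalgebras (here containing the unit). *)

(* Defs.v *)
From HB Require Import structures.
From mathcomp Require Import all_boot all_order all_algebra.
From mathcomp Require Import complex.
From mathcomp Require Import all_classical all_reals all_analysis.

Set Implicit Arguments.
Unset Strict Implicit.
Unset Printing Implicit Defensive.

Import Order.TTheory GRing.Theory Num.Theory.
Import numFieldNormedType.Exports.

Local Open Scope classical_set_scope.
Local Open Scope ring_scope.

(* MathComp structures cannot be joined here: a HB structure inheriting from
   both rings and normed modules lacks a join with Num.NumDomain. Hence a
   C*-algebra is a record over a complete normed module, and the ring and
   algebra structures are declared on its carrier below.
   The norm of a normed module over R[i] takes its values in R[i]; the order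
   of R[i] makes `|x| a nonnegative real number. As MathComp algebras satisfy
   1 != 0, the zero algebra, which has no state, is excluded. *)
Record cstarAlgType (R : realType) := CStarAlg {
  cstar_base : completeNormedModType R[i] ;
  cstar_one : cstar_base ;
  cstar_mul : cstar_base -> cstar_base -> cstar_base ;
  cstar_star : cstar_base -> cstar_base ;
  cstar_mulA : associative cstar_mul ;
  cstar_mul1x : left_id cstar_one cstar_mul ;
  cstar_mulx1 : right_id cstar_one cstar_mul ;
  cstar_mulDl : left_distributive cstar_mul +%R ;
  cstar_mulDr : right_distributive cstar_mul +%R ;
  cstar_one_neq0 : cstar_one != 0 ;
  cstar_scaleAl : forall (k : R[i]) (x y : cstar_base),
    k *: cstar_mul x y = cstar_mul (k *: x) y ;
  cstar_scaleAr : forall (k : R[i]) (x y : cstar_base),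
    k *: cstar_mul x y = cstar_mul x (k *: y) ;
  cstar_starK : involutive cstar_star ;
  cstar_starD : forall x y : cstar_base,
    cstar_star (x + y) = cstar_star x + cstar_star y ;
  cstar_starZ : forall (k : R[i]) (x : cstar_base),
    cstar_star (k *: x) = Num.conj k *: cstar_star x ;
  cstar_starM : forall x y : cstar_base,
    cstar_star (cstar_mul x y) = cstar_mul (cstar_star y) (cstar_star x) ;
  cstar_norm_submul : forall x y : cstar_base,
    `|cstar_mul x y| <= `|x| * `|y| ;
  cstar_norm_starM : forall x : cstar_base,
    `|cstar_mul (cstar_star x) x| = `|x| ^+ 2
}.

Definition cstar_sort (R : realType) (A : cstarAlgType R) : Type :=
  cstar_base A.
Coercion cstar_sort : cstarAlgType >-> Sortclass.

HB.instance Definition _ (R : realType) (A : cstarAlgType R) :=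
  CompleteNormedModule.copy (cstar_sort A) (cstar_base A).

HB.instance Definition _ (R : realType) (A : cstarAlgType R) :=
  GRing.Zmodule_isNzRing.Build (cstar_sort A)
    (@cstar_mulA R A) (@cstar_mul1x R A) (@cstar_mulx1 R A)
    (@cstar_mulDl R A) (@cstar_mulDr R A) (@cstar_one_neq0 R A).

HB.instance Definition _ (R : realType) (A : cstarAlgType R) :=
  GRing.Lmodule_isLalgebra.Build R[i] (cstar_sort A) (@cstar_scaleAl R A).

HB.instance Definition _ (R : realType) (A : cstarAlgType R) :=
  GRing.Lalgebra_isAlgebra.Build R[i] (cstar_sort A) (@cstar_scaleAr R A).

Definition star (R : realType) (A : cstarAlgType R) (x : A) : A :=
  cstar_star x.

Section CStarAlgebraDefs.
Variables (R : realType) (A : cstarAlgType R).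
Implicit Types (B D M : set A) (f : A -> R[i]).

Definition unital_cstar_subalgebra B :=
  [/\ B 1,
      forall (k : R[i]) x y, B x -> B y -> B (k *: x + y),
      forall x y, B x -> B y -> B (x * y),
      forall x, B x -> B (star x)
    & closed B].

Definition commutative_subset B := forall x y, B x -> B y -> x * y = y * x.

Definition finite_dimensional B :=
  exists (n : nat) (e : 'I_n -> A), (forall i, B (e i)) /\
    forall x, B x -> exists c : 'I_n -> R[i], x = \sum_(i < n) c i *: e i.

Definition approximately_finite B :=
  exists F : nat -> set A,
    [/\ forall n, unital_cstar_subalgebra (F n) /\ finite_dimensional (F n),
        forall n, F n `<=` F n.+1
      & B = closure (\bigcup_n F n)].

Definition mxstar n (X : 'M[A]_n) : 'M[A]_n := \matrix_(i, j) star (X j i).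

(* Positive elements of the C*-algebra M_n(B), for a C*-subalgebra B of A. *)
Definition mx_positive B n (P : 'M[A]_n) :=
  exists X : 'M[A]_n, (forall i j, B (X i j)) /\ P = mxstar X *m X.

(* Complete positivity of the restriction of T to B, as a map from B to D. *)
Definition completely_positive B D (T : A -> A) :=
  forall (n : nat) (P : 'M[A]_n),
    mx_positive B P -> mx_positive D (map_mx T P).

(* Only the restriction of f to B matters: functionals on a C*-subalgebra B are
   represented by functions on A whose values outside B are irrelevant. *)
Definition state_on B f :=
  [/\ forall (k : R[i]) x y, B x -> B y -> f (k *: x + y) = k * f x + f y,
      forall x, B x -> 0 <= f (star x * x)
    & f 1 = 1].

Definition faithful_on B f := forall x, B x -> f (star x * x) = 0 -> x = 0.

Definition conditional_expectation M (E : A -> A) :=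
  [/\ linear E,
      (forall a, M (E a)) /\ (forall m, M m -> E m = m),
      forall a, `|E a| <= `|a|,
      completely_positive setT M E
    & forall m m' a, M m -> M m' -> E (m * a * m') = m * E a * m'].

End CStarAlgebraDefs.

(* Main.v *)
(* Positivity in A is handled through the real norm and square roots: a
   self-adjoint h is a square of a self-adjoint element iff ||t - h|| <= t for
   some t, which makes the positive elements a convex cone, and Kaplansky's
   argument puts all x^* x into it.

   Existence.  Let p(a) be the infimum of Re mu(c) over the c in C such that
   c + (b - sigma b) + x - a has positive real part for some b and some sum x of
   terms u b u^* - b with u a unitary of C.  Any real linear functional dominated
   by the sublinear p is the real part of the required state, so by Hahn-Banach
   one only needs p(0) >= 0.  This is the Markov-Kakutani argument: Cesaro means
   of sigma, then of the maps u . u^*, are positive, preserve mu on C, and make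
   b - sigma b and x arbitrarily small.  As C is spanned by its unitaries,
   invariance under u . u^* is property (2).

   Conditional expectation.  M is spanned by orthogonal minimal projections p_i,
   found as multiples of joint eigenvectors, and
   E(a) = sum_i (phi(p_i a) / phi(p_i)) p_i.  Complete positivity reduces to
   the factorization of the positive semidefinite scalar matrices
   phi(p_i P_kl) / phi(p_i).  Uniqueness holds since phi(m E(a)) = phi(m a) for
   m in M and phi is faithful on M. *)
Require Import Defs.
From HB Require Import structures.
From mathcomp Require Import all_boot all_order all_algebra.
From mathcomp Require Import complex.
From mathcomp Require Import all_classical all_reals all_analysis.
From mathcomp Require Import ring lra.

Set Implicit Arguments.
Unset Strict Implicit.
Unset Printing Implicit Defensive.

Import Order.TTheory GRing.Theory Num.Theory.
Import numFieldNormedType.Exports.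

Local Open Scope classical_set_scope.
Local Open Scope ring_scope.

Local Notation "r %:C" := (real_complex _ r) (format "r %:C") : ring_scope.

Ltac expand :=
  rewrite ?(mulrDl, mulrDr, mulrN, mulNr, mulr1, mul1r, mulr0, mul0r, mulrA,
            opprD, opprK, oppr0).

Local Notation tailpat := (X in _ + X)%pattern.

Ltac cancel_head :=
  match goal with
  | |- is_true (- ?t + _ == 0) =>
      rewrite ?[in tailpat](addrCA _ t) addKr
  | |- is_true (?t + _ == 0) =>
      rewrite ?[in tailpat](addrCA _ (- t)) addNKr
  end.

(* Decides identities of the free abelian group on the noncommutative
   monomials, after distributing products over sums. *)
Ltac noncomm :=
  apply/eqP; rewrite -subr_eq0; expand; rewrite ?(addr0, add0r);
  rewrite -[eqbLHS]addr0 -?addrA; repeat cancel_head; exact: eqxx.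

(** * The real norm *)

Section Norm.
Variables (R : realType) (A : cstarAlgType R).
Implicit Types (x y z : A) (k : R[i]) (r : R).

(** The norm as an element of R, where [lra] and [nra] apply; [normE] recovers the norm with values
    in [R[i]]. *)
Definition nm x : R := complex.Re `|x|.

Lemma normE x : `|x| = (nm x)%:C.
Proof. by rewrite /nm RRe_real // normr_real. Qed.

Lemma nm_ge0 x : 0 <= nm x.
Proof. by rewrite -lecR -normE; exact: normr_ge0. Qed.

Lemma nmD x y : nm (x + y) <= nm x + nm y.
Proof. by rewrite -lecR rmorphD /= -!normE ler_normD. Qed.

Lemma nmN x : nm (- x) = nm x.
Proof. by rewrite /nm normrN. Qed.

Lemma nmBC x y : nm (x - y) = nm (y - x).
Proof. by rewrite /nm distrC. Qed.

Lemma nm0 : nm (0 : A) = 0.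
Proof. by rewrite /nm normr0. Qed.

Lemma nm_eq0 x : nm x = 0 -> x = 0.
Proof. by move=> x0; apply/eqP; rewrite -normr_eq0 normE x0. Qed.

Lemma nmM x y : nm (x * y) <= nm x * nm y.
Proof. by rewrite -lecR rmorphM /= -!normE; exact: cstar_norm_submul. Qed.

Lemma nmZ k x : nm (k *: x) = complex.Re `|k| * nm x.
Proof.
rewrite /nm normrZ normE -[`|k|]RRe_real ?normr_real //.
by rewrite -rmorphM.
Qed.

Lemma nmZr r x : nm (r%:C *: x) = `|r| * nm x.
Proof. by rewrite nmZ normc_def /= expr0n /= addr0 sqrtr_sqr. Qed.

Lemma nm_starM x : nm (star x * x) = nm x ^+ 2.
Proof.
have: `|star x * x| = `|x| ^+ 2 by exact: cstar_norm_starM.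
by rewrite !normE -rmorphXn => /(congr1 (@complex.Re R)).
Qed.

Lemma starK : involutive (@star R A). Proof. exact: cstar_starK. Qed.
Lemma starD x y : star (x + y) = star x + star y.
Proof. exact: cstar_starD. Qed.
Lemma starZ k x : star (k *: x) = Num.conj k *: star x.
Proof. exact: cstar_starZ. Qed.
Lemma starM x y : star (x * y) = star y * star x.
Proof. exact: cstar_starM. Qed.

Lemma star0 : star (0 : A) = 0.
Proof. by apply: (addrI (star 0)); rewrite -starD !addr0. Qed.
Lemma starN x : star (- x) = - star x.
Proof. by apply: (addrI (star x)); rewrite -starD !subrr star0. Qed.
Lemma starB x y : star (x - y) = star x - star y.
Proof. by rewrite starD starN. Qed.
Lemma star1 : star (1 : A) = 1.
Proof. by rewrite -[LHS]mulr1 -{2}(starK 1) -starM mulr1 starK. Qed.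
Lemma conj_real r : Num.conj (r%:C) = r%:C.
Proof. by apply: conj_Creal; apply/complex_realP; exists r. Qed.
Lemma starZr r x : star (r%:C *: x) = r%:C *: star x.
Proof. by rewrite starZ conj_real. Qed.
Lemma star_sum (I : Type) (s : seq I) (P : pred I) (F : I -> A) :
  star (\sum_(i <- s | P i) F i) = \sum_(i <- s | P i) star (F i).
Proof. exact: (big_morph (@star R A) starD star0). Qed.

Lemma nm1 : nm (1 : A) = 1.
Proof.
have := nm_starM 1; rewrite star1 mulr1 expr2 => /eqP.
rewrite -subr_eq0 -{1}[nm 1]mulr1 -mulrBr mulf_eq0 => /orP[/eqP /nm_eq0/eqP|].
  by rewrite oner_eq0.
by rewrite subr_eq0 => /eqP <-.
Qed.

(** The C*-identity and submultiplicativity bound [nm y ^+ 2] by [nm (star y) * nm y]; cancel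
    [nm y], then apply the bound to [star y] as well. *)
Lemma nm_star x : nm (star x) = nm x.
Proof.
have key y : nm y <= nm (star y).
  have := nm_ge0 y; rewrite le0r => /orP[/eqP ->|y0]; first exact: nm_ge0.
  by rewrite -(ler_pM2r y0) -expr2 -nm_starM nmM.
by apply/le_anti; rewrite key -{2}(starK x) key.
Qed.

Lemma nm_sa_sqr x : star x = x -> nm (x * x) = nm x ^+ 2.
Proof. by move=> {1}<-; exact: nm_starM. Qed.

(** Identities between limits are proved in this form: the difference is at most a fixed multiple of
    every positive [e]. *)
Lemma nm_small (K : R) x : (forall e, 0 < e -> nm x <= e * K) -> x = 0.
Proof.
move=> small; apply: nm_eq0; apply/eqP/negPn/negP => x0.
have xgt0 : 0 < nm x by rewrite lt0r x0 nm_ge0.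
have K0 : 0 < K.
  by have := lt_le_trans xgt0 (small 1 ltr01); rewrite mul1r.
have e0 : 0 < nm x / (K * 2) by apply: divr_gt0 => //; lra.
have := small _ e0.
have -> : nm x / (K * 2) * K = nm x / 2 by field; rewrite gt_eqF.
lra.
Qed.

End Norm.

(** * Square roots *)

Section SquareRoot.
Variables (R : realType) (A : cstarAlgType R) (B : set A).
Hypothesis B_subalg : unital_cstar_subalgebra B.
Implicit Types (x y z : A) (k : R[i]) (r : R).

Lemma subalgD x y : B x -> B y -> B (x + y).
Proof. by case: B_subalg => _ + _ _ _ Bx By => /(_ 1 x y Bx By); rewrite scale1r. Qed.
Lemma subalgM x y : B x -> B y -> B (x * y).
Proof. by case: B_subalg => _ _ + _ _; apply. Qed.
Lemma subalg_star x : B x -> B (star x).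
Proof. by case: B_subalg => _ _ _ + _; apply. Qed.
Lemma subalg1 : B 1. Proof. by case: B_subalg. Qed.
Lemma subalg0 : B 0.
Proof.
case: B_subalg => B1 + _ _ _ => /(_ (-1) 1 1 B1 B1).
by rewrite scaleN1r addNr.
Qed.
Lemma subalgZ k x : B x -> B (k *: x).
Proof.
case: B_subalg => _ BZ _ _ _ Bx.
by rewrite -[_ *: _]addr0; apply: BZ => //; exact: subalg0.
Qed.
Lemma subalgN x : B x -> B (- x).
Proof. by rewrite -scaleN1r; exact: subalgZ. Qed.
Lemma subalgB x y : B x -> B y -> B (x - y).
Proof. by move=> Bx By; apply: subalgD => //; exact: subalgN. Qed.
Lemma subalg_sum (I : Type) (s : seq I) (P : pred I) (F : I -> A) :
  (forall i, P i -> B (F i)) -> B (\sum_(i <- s | P i) F i).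
Proof. by move=> BF; apply: (big_ind B) => //; [exact: subalg0|exact: subalgD]. Qed.

Section Visser.
Variable g : A.

Fixpoint visser n : A :=
  if n is m.+1 then (2^-1)%:C *: (g + visser m * visser m) else 0.

Fixpoint rvisser n : R :=
  if n is m.+1 then 2^-1 * (1 + rvisser m * rvisser m) else 0.

Lemma rvisser_bound n : 0 <= rvisser n <= 1.
Proof.
elim: n => [|n /andP[r0 r1]] /=; first by rewrite lexx ler01.
by apply/andP; split; nra.
Qed.

Hypothesis g1 : nm g <= 1.

Lemma visser_bound n : nm (visser n) <= rvisser n.
Proof.
elim: n => [|n IH] /=; first by rewrite nm0.
rewrite nmZr ger0_norm; last by lra.
apply: ler_wpM2l; first by lra.
apply: (le_trans (nmD _ _)); apply: lerD => //.
apply: (le_trans (nmM _ _)).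
by apply: ler_pM => //; exact: nm_ge0.
Qed.

(** Every iterate is a polynomial in [g]. *)
Lemma visser_comm z n : g * z = z * g -> visser n * z = z * visser n.
Proof.
move=> gz; elim: n => [|n IH] /=; first by rewrite mul0r mulr0.
rewrite -scalerAl -scalerAr mulrDl mulrDr gz; congr (_ *: (_ + _)).
by rewrite -mulrA IH mulrA IH mulrA.
Qed.

Lemma visser_comm2 m n : visser m * visser n = visser n * visser m.
Proof. by apply: visser_comm; rewrite visser_comm. Qed.

(** Since iterates commute, each increment is half the previous one times the sum of the two
    iterates; the scalar increments obey the same recursion with larger factors. *)
Lemma visser_diff n :
  nm (visser n.+1 - visser n) <= rvisser n.+1 - rvisser n.
Proof.
elim: n => [|n IH].
  rewrite /= !subr0 mulr0 mul0r !addr0 nmZr ger0_norm; last by lra.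
  by apply: ler_wpM2l => //; lra.
have -> : visser n.+2 - visser n.+1
    = (2^-1)%:C *: ((visser n.+1 - visser n) * (visser n.+1 + visser n)).
  rewrite {1}/visser -/visser [in X in _ - X]/visser -/visser -scalerBr.
  rewrite opprD addrACA subrr add0r; congr (_ *: _).
  rewrite -/(visser n.+1).
  rewrite mulrBl !mulrDr (visser_comm2 n n.+1) opprD addrA; congr (_ - _).
  by rewrite addrK.
rewrite nmZr ger0_norm; last by lra.
have -> : rvisser n.+2 - rvisser n.+1 =
    2^-1 * ((rvisser n.+1 - rvisser n) * (rvisser n.+1 + rvisser n)).
  by rewrite {1}/rvisser -/rvisser -/(rvisser n.+1) [rvisser n.+1 in X in _ - X]/=; ring.
apply: ler_wpM2l; first by lra.
apply: (le_trans (nmM _ _)); apply: ler_pM => //; try exact: nm_ge0.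
by apply: (le_trans (nmD _ _)); apply: lerD; exact: visser_bound.
Qed.

Lemma visser_dist m n :
  nm (visser (m + n) - visser m) <= rvisser (m + n) - rvisser m.
Proof.
elim: n => [|n IH]; first by rewrite addn0 !subrr nm0.
rewrite addnS -(subrKA (visser (m + n))) -(subrKA (rvisser (m + n))).
by apply: (le_trans (nmD _ _)); apply: lerD => //; exact: visser_diff.
Qed.

(** The increments are dominated by those of [rvisser], which is bounded by 1: once [rvisser N] is
    close to its supremum, all later iterates are close to [visser N]. *)
Lemma visser_cvg : exists l : A, visser @ \oo --> l /\
  (forall e : R, 0 < e -> exists N, forall n, nm (l - visser (N + n)) <= e).
Proof.
have hs : has_sup (range rvisser).
  split; first by exists (rvisser 0), 0%N.
  by exists 1 => _ [n _ <-]; case/andP: (rvisser_bound n).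
have cauchy_ : cauchy (visser @ \oo).
  apply: cauchy_exP => e e0.
  have e'0 : 0 < complex.Re e by move: e0; rewrite ltcE => /andP[].
  have eE : e = (complex.Re e)%:C by rewrite RRe_real // gtr0_real.
  have [_ [N _ <-] HN] := sup_adherent e'0 hs.
  exists (visser N); exists N => // n /= Nn.
  rewrite -ball_normE /= normE eE ltcR nmBC -(subnKC Nn).
  apply: (le_lt_trans (visser_dist _ _)).
  have : rvisser (N + (n - N)) <= sup (range rvisser).
    by apply: ub_le_sup; [case: hs|exists (N + (n - N))%N].
  lra.
have /cauchy_cvgP/cvg_ex[l cvg_l] := cauchy_.
exists l; split=> // e e0.
have e0' : 0 < e%:C :> R[i] by rewrite ltcR.
have /cvgrPdist_le /(_ _ e0')[N _ HN] := cvg_l.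
exists N => n; rewrite -lecR -normE; apply: HN => /=; exact: leq_addr.
Qed.

Hypothesis g_sa : star g = g.
Hypothesis B_g : B g.

Lemma visser_sa n : star (visser n) = visser n.
Proof.
by elim: n => [|n IH] /=; rewrite ?star0 // starZr starD starM g_sa IH.
Qed.

Lemma subalg_visser n : B (visser n).
Proof.
elim: n => [|n IH] /=; first exact: subalg0.
by apply/subalgZ/subalgD => //; exact: subalgM.
Qed.

(* Visser's iteration y := (g + y^2)/2 is dominated by the scalar iteration with
   g = 1; its limit satisfies (1 - y)^2 = 1 - g. *)
Lemma sqrt_unit_ball : exists y, [/\ B y, star y = y, nm y <= 1,
  (1 - y) * (1 - y) = 1 - g & forall z, g * z = z * g -> y * z = z * y].
Proof.
have [l [cvg_l lP]] := visser_cvg.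
have l1 : nm l <= 1.
  apply/ler_addgt0Pr => e e0; have [N /(_ 0%N)] := lP _ e0; rewrite addn0 => HN.
  rewrite -(subrK (visser N) l); apply: (le_trans (nmD _ _)).
  have := visser_bound N; have /andP[_] := rvisser_bound N.
  lra.
exists l; split=> //.
- have [_ _ _ _ clB] := B_subalg.
  apply: (@closed_cvg _ _ \oo _ visser B clB _ _ cvg_l).
  by apply: nearW => n; exact: subalg_visser.
- apply/eqP; rewrite -subr_eq0; apply/eqP; apply: (@nm_small _ _ 2) => e e0.
  have [N /(_ 0%N)] := lP _ e0; rewrite addn0 => HN.
  rewrite -(subrKA (visser N)) -{1}visser_sa -starB.
  apply: (le_trans (nmD _ _)); rewrite nm_star (nmBC (visser N)).
  lra.
(* The limit is a fixed point of the iteration. The error is at most [e] for replacing [l] by the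
   iterate N+1, plus half of [e + e] for replacing [l * l] by the square of the iterate N, as [l]
   and the iterates have norm at most 1. *)
- have lE : l = (2^-1)%:C *: (g + l * l).
    apply/eqP; rewrite -subr_eq0; apply/eqP; apply: (@nm_small _ _ 2) => e e0.
    have [N HN] := lP _ e0.
    have := HN 0%N; have := HN 1%N; rewrite addn0 addn1 => HN1 HN0.
    rewrite -(subrKA (visser N.+1)) {2}/visser -/visser -scalerBr.
    apply: (le_trans (nmD _ _)); rewrite nmZr ger0_norm; last by lra.
    rewrite opprD addrACA subrr add0r.
    rewrite -[X in 2^-1 * nm X](subrKA (visser N * l)) -mulrBr -mulrBl.
    have := nmM (visser N) (visser N - l).
    have := nmM (visser N - l) l.
    have := nmD (visser N * (visser N - l)) ((visser N - l) * l).
    rewrite (nmBC (visser N)).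
    have := visser_bound N; have /andP[_ ?] := rvisser_bound N.
    have := nm_ge0 (l - visser N); have := nm_ge0 (visser N).
    have := nm_ge0 l.
    nra.
  have lE2 : l + l = g + l * l.
    rewrite -[RHS]scale1r {1 2}lE -scalerDl -rmorphD; congr (_%:C *: _).
    by rewrite -[RHS](divff (_ : 2 != 0 :> R)) //; lra.
  have llE : l * l = l + l - g by rewrite lE2 addrC addKr.
  rewrite mulrBl !mulrBr !mulr1 mul1r llE.
  noncomm.
- move=> z gz; apply/eqP; rewrite -subr_eq0; apply/eqP.
  apply: (@nm_small _ _ (2 * nm z)) => e e0.
  have [N /(_ 0%N)] := lP _ e0; rewrite addn0 => HN.
  rewrite -(subrKA (visser N * z)) {2}visser_comm // -mulrBl -mulrBr.
  apply: (le_trans (nmD _ _)).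
  have := nmM (l - visser N) z; have := nmM z (visser N - l).
  rewrite (nmBC (visser N)).
  have := nm_ge0 z.
  nra.
Qed.

End Visser.
End SquareRoot.

(** * The positive cone *)

Section Positivity.
Variables (R : realType) (A : cstarAlgType R).
Implicit Types (x y z h s p : A) (k : R[i]) (r t c : R).

(** Squares of self-adjoint elements, so that no spectrum is involved; that this covers all
    [star x * x] is [pos_starM]. *)
Definition pos h := exists s, star s = s /\ h = s * s.

Lemma unital_cstar_subalgebraT : unital_cstar_subalgebra [set: A].
Proof. by split=> //; exact: closedT. Qed.

Lemma scalerAC r t x : r%:C *: (t%:C *: x) = (r * t)%:C *: x.
Proof. by rewrite scalerA -rmorphM. Qed.

Lemma scalerDC r t x : r%:C *: x + t%:C *: x = (r + t)%:C *: x.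
Proof. by rewrite -scalerDl -rmorphD. Qed.

Lemma conj_i : Num.conj 'i%C = - 'i%C :> R[i].
Proof. by apply/eqP; rewrite eq_complex /= oppr0 !eqxx. Qed.

Lemma mulC_ii : 'i%C * 'i%C = -1 :> R[i].
Proof. by rewrite -expr2 sqr_i. Qed.

Lemma scale_half_double x : (2^-1)%:C *: (x + x) = x.
Proof.
rewrite scalerDr scalerDC -[RHS]scale1r; congr (_%:C *: _).
by field.
Qed.

Lemma nm_double x : nm (x + x) = 2 * nm x.
Proof.
by rewrite -[X in _ * nm X]scale_half_double nmZr ger0_norm ?invr_ge0 ?ler0n // mulrA divff ?mul1r // pnatr_eq0.
Qed.

Lemma nm_scalar c : nm (c%:C *: (1 : A)) = `|c|.
Proof. by rewrite nmZr nm1 mulr1. Qed.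

(** With [u = s + i w], commutation gives [star u * u = s * s + w * w], while [s] is the mean of [u]
    and [star u], two elements of equal norm. *)
Lemma sqr_nm_le_sum s w : star s = s -> star w = w -> s * w = w * s ->
  nm s ^+ 2 <= nm (s * s + w * w).
Proof.
move=> s_sa w_sa sw; set u := s + 'i%C *: w.
have uE : star u = s - 'i%C *: w.
  by rewrite /u starD s_sa starZ conj_i w_sa scaleNr.
have <- : star u * u = s * s + w * w.
  rewrite uE /u mulrDl !mulrDr !mulNr -!scalerAl -!scalerAr scalerA mulC_ii scaleN1r opprK.
  by rewrite sw; noncomm.
rewrite nm_starM; apply: lerXn2r; rewrite ?nnegrE ?nm_ge0 //.
have <- : (2^-1)%:C *: (u + star u) = s.
  rewrite uE -[RHS]scale_half_double /u; congr (_ *: _); noncomm.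
rewrite nmZr ger0_norm ?invr_ge0 ?ler0n //.
by have := nmD u (star u); rewrite nm_star; lra.
Qed.

(** Write [h = t (1 - g)] with [nm g <= 1]: if [(1 - y)^2 = 1 - g], then [sqrt t (1 - y)] is a root
    of [h]. The bound on [r - s] makes the root itself positive, through [ball_pos]. *)
Lemma sqrt_scaled_ball (B : set A) t h : unital_cstar_subalgebra B ->
  B h -> star h = h -> nm (t%:C *: 1 - h) <= t ->
  exists s, [/\ B s, star s = s, s * s = h,
    (exists r, 0 <= r /\ nm (r%:C *: 1 - s) <= r)
    & forall z, h * z = z * h -> s * z = z * s].
Proof.
move=> HB Bh h_sa ht.
have t0 : 0 <= t by apply: le_trans ht; exact: nm_ge0.
(* For [t = 0] the hypothesis forces [h = 0], and rescaling by [t^-1] is meaningless. *)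
have [tE|tn0] := eqVneq t 0.
  have h0 : h = 0.
    apply: nm_eq0; apply/le_anti; rewrite nm_ge0 andbT.
    by move: ht; rewrite tE scale0r sub0r nmN.
  rewrite h0; exists 0; split=> [||||z _].
  - exact: subalg0.
  - by rewrite star0.
  - by rewrite mulr0.
  - by exists 0; rewrite scale0r subr0 nm0.
  - by rewrite mulr0 mul0r.
have tgt0 : 0 < t by rewrite lt0r tn0.
pose g := (t^-1)%:C *: (t%:C *: 1 - h).
have gE : g = 1 - (t^-1)%:C *: h.
  by rewrite /g scalerBr scalerAC mulVf // scale1r.
have [|||y [By y_sa y1 ysq ycomm]] := @sqrt_unit_ball _ _ _ HB g.
- rewrite /g nmZr ger0_norm ?invr_ge0 //.
  by rewrite mulrC ler_pdivrMr // mul1r.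
- by rewrite gE starB star1 starZr h_sa.
- rewrite gE; apply: subalgB => //; first exact: subalg1.
  exact: subalgZ.
exists ((Num.sqrt t)%:C *: (1 - y)); split.
- by apply: subalgZ => //; apply: subalgB => //; exact: subalg1.
- by rewrite starZr starB star1 y_sa.
- rewrite -scalerAl -scalerAr ysq scalerAC -expr2 sqr_sqrtr // gE subKr.
  by rewrite scalerAC divff // scale1r.
- exists (Num.sqrt t); rewrite sqrtr_ge0; split=> //.
  rewrite -scalerBr subKr nmZr ger0_norm ?sqrtr_ge0 //.
  by rewrite ler_piMr ?sqrtr_ge0.
- move=> z hz; rewrite -scalerAl -scalerAr; congr (_ *: _).
  have yz : y * z = z * y.
    apply: ycomm; rewrite gE mulrBl mulrBr mul1r mulr1.
    by rewrite -scalerAl -scalerAr hz.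
  by rewrite mulrBl mulrBr mul1r mulr1 yz.
Qed.

Lemma pos_sa h : pos h -> star h = h.
Proof. by move=> [s [s_sa ->]]; rewrite starM s_sa. Qed.

(** The element [t - s^2] lies within [t] of [t], hence has a root [w] commuting with [s]; then
    [w^2 + s^2 = t] bounds the norm of [w^2] by [t]. *)
Lemma pos_ball h t : pos h -> nm h <= t -> nm (t%:C *: 1 - h) <= t.
Proof.
move=> [s [s_sa ->]]; rewrite nm_sa_sqr // => st.
have t0 : 0 <= t by apply: le_trans st; exact: sqr_ge0.
have ss_sa : star (s * s) = s * s by rewrite starM s_sa.
have [||w [_ w_sa wE _ wcomm]] :=
    @sqrt_scaled_ball _ t (t%:C *: 1 - s * s) unital_cstar_subalgebraT I.
- by rewrite starB starZr star1 ss_sa.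
- by rewrite subKr nm_sa_sqr.
rewrite -wE nm_sa_sqr //.
have := @sqr_nm_le_sum w s w_sa s_sa.
rewrite wE subrK nm_scalar ger0_norm //; apply; apply: wcomm.
by rewrite mulrBl mulrBr -scalerAl -scalerAr mul1r mulr1 mulrA.
Qed.

Lemma ball_pos h t : star h = h -> nm (t%:C *: 1 - h) <= t -> pos h.
Proof.
move=> h_sa ht.
have [s [_ s_sa <- _ _]] := sqrt_scaled_ball unital_cstar_subalgebraT I h_sa ht.
by exists s.
Qed.

Lemma pos_sqrt (B : set A) h : unital_cstar_subalgebra B -> B h -> pos h ->
  exists s, [/\ B s, star s = s, s * s = h, pos s
    & forall z, h * z = z * h -> s * z = z * s].
Proof.
move=> HB Bh h0; have := pos_ball h0 (lexx _).
move=> /(sqrt_scaled_ball HB Bh (pos_sa h0)) [s [Bs s_sa sE [r [_ rs]] sc]].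
by exists s; split=> //; exact: ball_pos rs.
Qed.

Lemma pos_sqr s : star s = s -> pos (s * s).
Proof. by exists s. Qed.

Lemma pos0 : pos 0.
Proof. by exists 0; rewrite star0 mulr0. Qed.

Lemma pos1 : pos 1.
Proof. by exists 1; rewrite star1 mulr1. Qed.

(** In the norm description of positivity, centres and radii of balls simply add. *)
Lemma posD h p : pos h -> pos p -> pos (h + p).
Proof.
move=> h0 p0; apply: (@ball_pos _ (nm h + nm p)).
  by rewrite starD !pos_sa.
have -> : (nm h + nm p)%:C *: 1 - (h + p) =
    ((nm h)%:C *: 1 - h) + ((nm p)%:C *: 1 - p).
  by rewrite -scalerDC; noncomm.
by apply: (le_trans (nmD _ _)); apply: lerD; exact: pos_ball.
Qed.

Lemma posZ r h : 0 <= r -> pos h -> pos (r%:C *: h).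
Proof.
move=> r0 [s [s_sa ->]]; exists ((Num.sqrt r)%:C *: s); split.
  by rewrite starZr s_sa.
by rewrite -scalerAl -scalerAr scalerAC -(expr2 (Num.sqrt r)) sqr_sqrtr.
Qed.

Lemma pos_sum (I : Type) (s : seq I) (P : pred I) (F : I -> A) :
  (forall i, P i -> pos (F i)) -> pos (\sum_(i <- s | P i) F i).
Proof. by move=> F0; apply: (big_ind pos) => //; [exact: pos0|exact: posD]. Qed.

Lemma sa_pos h t : star h = h -> nm h <= t -> pos (t%:C *: 1 - h).
Proof.
move=> h_sa ht; apply: (@ball_pos _ t); last by rewrite subKr.
by rewrite starB starZr star1 h_sa.
Qed.

Lemma posM h p : pos h -> pos p -> h * p = p * h -> pos (h * p).
Proof.
move=> h0 p0 hp.
have [s [_ s_sa sE _ sc]] := pos_sqrt unital_cstar_subalgebraT I h0.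
have sp := sc _ hp.
have [q [_ q_sa qE _ qc]] := pos_sqrt unital_cstar_subalgebraT I p0.
have qs : q * s = s * q by apply: qc.
rewrite -sE -qE; exists (s * q); rewrite starM s_sa q_sa qs; split=> //.
by rewrite -!mulrA; congr (_ * _); rewrite !mulrA qs.
Qed.

(** Commuting roots of [p] and of [c - p] have squares summing to [c], so [sqr_nm_le_sum]
    applies. *)
Lemma pos_nm_le p c : 0 <= c -> pos p -> pos (c%:C *: 1 - p) -> nm p <= c.
Proof.
move=> c0 p0 cp0.
have [s [_ s_sa sE _ sc]] := pos_sqrt unital_cstar_subalgebraT I p0.
have [w [_ w_sa wE _ wc]] := pos_sqrt unital_cstar_subalgebraT I cp0.
rewrite -sE nm_sa_sqr //.
have := @sqr_nm_le_sum s w s_sa w_sa.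
rewrite sE wE addrC subrK nm_scalar ger0_norm //; apply.
rewrite wc // mulrBl mulrBr -scalerAl -scalerAr mul1r mulr1.
by rewrite sc.
Qed.

(** Replaces the comparison of the spectra of [star z * z] and [z * star z]. For [nm z = 1], the
    element [w = z * star z] is positive, with [w + w^2 <= 1] and [w^2 <= w]; hence [2 w^2 <= 1],
    although [w^2] has norm 1. *)
Lemma neg_starM y : pos (- (star y * y)) -> y = 0.
Proof.
have unit_case z : pos (- (star z * z)) -> nm z = 1 -> False.
  move=> v0 z1; set v := star z * z in v0; pose w := z * star z.
  have v1 : nm v = 1 by rewrite /v nm_starM z1 expr1n.
  have w1 : nm w = 1.
    by rewrite /w -{1}(starK z) nm_starM nm_star z1 expr1n.
  have w_sa : star w = w by rewrite /w starM starK.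
  have w0 : pos w.
    rewrite -(scale_half_double w); apply: posZ; first by rewrite invr_ge0 ler0n.
    pose a := z + star z; pose b := 'i%C *: (z - star z).
    (* The real and imaginary parts of [z] satisfy [a^2 + b^2 = 2 (w + v)], where [- v] is positive
       by assumption. *)
    have -> : w + w = a * a + b * b + ((- v) + (- v)).
      rewrite /b -scalerAl -scalerAr scalerA mulC_ii scaleN1r /a /v /w; noncomm.
    apply: posD; last exact: posD.
    apply: posD; apply: pos_sqr.
      by rewrite /a starD starK addrC.
    by rewrite /b starZ starB starK conj_i scaleNr -scalerN opprB.
  have ww_sa : star (w + w * w) = w + w * w by rewrite starD starM w_sa.
  have ww1 : nm (w + w * w) <= 1.
    have -> : w + w * w = z * (1%:C *: 1 - - v) * star z.
      by rewrite scale1r /v /w; noncomm.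
    apply: (le_trans (nmM _ _)); rewrite nm_star z1 mulr1.
    apply: (le_trans (nmM _ _)); rewrite z1 mul1r.
    by apply: pos_ball => //; rewrite nmN v1.
  have := sa_pos ww_sa ww1; rewrite scale1r => p1.
  have p2 : pos (w - w * w).
    have -> : w - w * w = w * (1 - w) by noncomm.
    apply: posM => //; last by noncomm.
    by have := @sa_pos w 1 w_sa; rewrite w1 lexx scale1r; apply.
  have : nm (w * w + w * w) <= 1.
    apply: pos_nm_le => //; first by apply: posD; apply: pos_sqr.
    have -> : 1%:C *: 1 - (w * w + w * w) = (1 - (w + w * w)) + (w - w * w).
      by rewrite scale1r; noncomm.
    exact: posD.
  by rewrite nm_double nm_sa_sqr // w1; lra.
move=> y0; apply/eqP/negPn/negP => yn0.
have ny : 0 < nm y.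
  rewrite lt0r nm_ge0 andbT; apply: contra yn0 => /eqP/nm_eq0 ->.
  by rewrite eqxx.
apply: (@unit_case ((nm y)^-1%:C *: y)).
  rewrite starZr -scalerAl -scalerAr scalerAC -scalerN.
  by apply: posZ => //; rewrite mulr_ge0 // invr_ge0 ltW.
by rewrite nmZr ger0_norm ?invr_ge0 ?(ltW ny) // mulVf // gt_eqF.
Qed.

(* Kaplansky's argument: with h = star x * x and k = |h|, the element y := x (k - h)
   satisfies - star y * y = k (k - h)^2 >= 0, hence vanishes. *)
Lemma pos_starM x : pos (star x * x).
Proof.
set h := star x * x.
have h_sa : star h = h by rewrite /h starM starK.
have [k [_ k_sa kE k0 kc]] :=
  pos_sqrt unital_cstar_subalgebraT I (pos_sqr h_sa).
have kh : k * h = h * k by apply: kc; rewrite mulrA.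
(* A root of [k] commuting with [h] and [k] exhibits [k (k - h)^2] as the square of the self-adjoint
   [q (k - h)]. *)
have [q [_ q_sa qE _ qc]] := pos_sqrt unital_cstar_subalgebraT I k0.
have qh : q * h = h * q by apply: qc.
have qk : q * k = k * q by apply: qc.
pose y := x * (k - h).
have y0 : y = 0.
  apply: neg_starM.
  have -> : - (star y * y) = (q * (k - h)) * (q * (k - h)).
    have -> : star y * y = (k - h) * h * (k - h).
      by rewrite /y starM starB k_sa h_sa /h !mulrA.
    have -> : (k - h) * h = h * (k - h) by rewrite mulrBl mulrBr kh.
    have -> : q * (k - h) * (q * (k - h)) = k * (k - h) * (k - h).
      have qd : q * (k - h) = (k - h) * q by rewrite mulrBl mulrBr qh qk.
      by rewrite !mulrA -(mulrA q) -qd mulrA qE.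
    have -> : k * (k - h) = - (h * (k - h)) by rewrite !mulrBr kE kh; noncomm.
    by rewrite mulNr.
  apply: pos_sqr; rewrite starM starB k_sa h_sa q_sa.
  by rewrite mulrBl mulrBr qh qk.
have hk : h * (k - h) = 0 by rewrite /h -mulrA -/y y0 mulr0.
(* From [h (k - h) = 0] follows [h k = h^2 = k^2]; a self-adjoint element of square zero vanishes,
   so [h = k] is positive. *)
have : (k - h) * (k - h) = 0.
  rewrite mulrBl hk subr0 mulrBr kE kh; move: hk.
  by rewrite mulrBr => /eqP; rewrite subr_eq0 => /eqP ->; rewrite subrr.
move=> d0; have d_sa : star (k - h) = k - h by rewrite starB k_sa h_sa.
have := nm_sa_sqr d_sa; rewrite d0 nm0 => /esym/eqP; rewrite sqrf_eq0.
by move=> /eqP/nm_eq0/eqP; rewrite subr_eq0 => /eqP <-.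
Qed.

Lemma pos_conj h x : pos h -> pos (star x * h * x).
Proof.
move=> [s [s_sa ->]].
have -> : star x * (s * s) * x = star (s * x) * (s * x).
  by rewrite starM s_sa !mulrA.
exact: pos_starM.
Qed.

Lemma starM_eq0 x : star x * x = 0 -> x = 0.
Proof.
by move=> x0; apply: neg_starM; rewrite x0 oppr0; exact: pos0.
Qed.

Lemma starM_le_nm x : pos ((nm x ^+ 2)%:C *: 1 - star x * x).
Proof. by apply: sa_pos; rewrite ?starM ?starK // nm_starM. Qed.

End Positivity.

(** * Hahn-Banach by minimal sublinear functionals *)

Section HahnBanach.
Variables (R : realType) (V : lmodType R[i]).
Implicit Types (p q f : V -> R) (x y : V) (r t : R).

(** V is treated as a real space. Applying the second inequality to [r^-1] turns it into an
    equality. *)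
Definition sublinear p :=
  (forall x y, p (x + y) <= p x + p y) /\
  (forall r x, 0 < r -> p (r%:C *: x) <= r * p x).

Lemma sublinearZ p r x : sublinear p -> 0 < r -> p (r%:C *: x) = r * p x.
Proof.
move=> [_ pZ] r0; apply/le_anti; rewrite pZ //= -ler_pdivlMl //.
have {1}-> : x = (r^-1)%:C *: (r%:C *: x).
  by rewrite scalerA -rmorphM mulVf ?gt_eqF // scale1r.
by apply: pZ; rewrite invr_gt0.
Qed.

Lemma sublinear0 p : sublinear p -> p 0 = 0.
Proof.
move=> hp; have := @sublinearZ p 2 0 hp (ltr0Sn _ _); rewrite scaler0; lra.
Qed.

Lemma sublinear_ge p q x : sublinear q -> (forall y, q y <= p y) ->
  - p (- x) <= q x.
Proof.
move=> hq qp; have [qD _] := hq.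
have := qD x (- x); rewrite subrr sublinear0 //; have := qp (- x); lra.
Qed.

(** The pointwise infimum is finite because members stay above [- p (- x)]. It is subadditive
    because, of two members used at [x] and [y], the smaller one serves at both points. *)
Lemma inf_chain p (F : set (V -> R)) : F !=set0 ->
  (forall q, F q -> sublinear q /\ forall x, q x <= p x) ->
  (forall q q', F q -> F q' -> (forall x, q' x <= q x) \/ (forall x, q x <= q' x)) ->
  exists2 m, sublinear m & forall q, F q -> forall x, m x <= q x.
Proof.
move=> [q0 Fq0] FP Ftot.
pose S x := [set q x | q in F].
have Sinf x : has_inf (S x).
  split; first by exists (q0 x), q0.
  by exists (- p (- x)) => _ [q /FP[hq qp] <-]; exact: sublinear_ge.
pose m x := inf (S x).
have m_le q x : F q -> m x <= q x.
  by move=> Fq; apply: ge_inf; [case: (Sinf x)|exists q].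
have le_m x (u : R) : (forall q, F q -> u <= q x) -> u <= m x.
  move=> ux; apply: lb_le_inf; first by case: (Sinf x).
  by move=> _ [q Fq <-]; exact: ux.
exists m; last by move=> q Fq x; exact: m_le.
split=> [x y|r x r0].
- rewrite -lerBlDr; apply: (le_m) => q Fq; rewrite lerBlDr -lerBlDl.
  apply: (le_m) => q' Fq'; rewrite lerBlDl.
  have [le|le] := Ftot _ _ Fq Fq'.
  + apply: (le_trans (m_le _ _ Fq')); have [[+ _] _] := FP _ Fq'.
    by move=> /(_ x y); have := le x; lra.
  + apply: (le_trans (m_le _ _ Fq)); have [[+ _] _] := FP _ Fq.
    by move=> /(_ x y); have := le y; lra.
- rewrite -ler_pdivrMl //; apply: (le_m) => q Fq.
  rewrite ler_pdivrMl //; apply: (le_trans (m_le _ _ Fq)).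
  by have [[_ +] _] := FP _ Fq; apply.
Qed.

(* For a minimal q this gives q = q', hence q x + q y <= q (x + y). *)
Lemma sublinear_shift q y : sublinear q ->
  exists q', [/\ sublinear q', forall x, q' x <= q x
                & forall x, q' x <= q (x + y) - q y].
Proof.
move=> hq; have [qD qZ] := hq.
(* The infimum over [t >= 0] is sublinear; [t = 0] gives the first bound and [t = 1] the second. *)
pose S x := [set q (x + t%:C *: y) - t * q y | t in [set t | 0 <= t]].
have Sle x t : 0 <= t -> - q (- x) <= q (x + t%:C *: y) - t * q y.
  move=> t0; have -> : t * q y = q (t%:C *: y).
    move: t0; rewrite le0r => /orP[/eqP ->|t0]; last by rewrite sublinearZ.
    by rewrite scale0r mul0r sublinear0.
  have := qD (x + t%:C *: y) (- x); rewrite addrAC subrr add0r; lra.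
have Sinf x : has_inf (S x).
  split; first by exists (q (x + 0%:C *: y) - 0 * q y), 0 => //=.
  by exists (- q (- x)) => _ [t /= t0 <-]; exact: Sle.
pose m x := inf (S x).
have m_le x t : 0 <= t -> m x <= q (x + t%:C *: y) - t * q y.
  by move=> t0; apply: ge_inf; [case: (Sinf x)|exists t].
have le_m x (u : R) : (forall t, 0 <= t -> u <= q (x + t%:C *: y) - t * q y) ->
    u <= m x.
  move=> ux; apply: lb_le_inf; first by case: (Sinf x).
  by move=> _ [t /= t0 <-]; exact: ux.
exists m; split.
- split=> [x x'|r x r0].
  + rewrite -lerBlDr; apply: (le_m) => t t0; rewrite lerBlDr -lerBlDl.
    apply: (le_m) => s s0; rewrite lerBlDl.
    apply: (le_trans (m_le _ (t + s) (addr_ge0 t0 s0))).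
    rewrite rmorphD /= scalerDl addrACA mulrDl.
    have := qD (x + t%:C *: y) (x' + s%:C *: y); lra.
  + rewrite -ler_pdivrMl //; apply: (le_m) => t t0.
    rewrite ler_pdivrMl //; apply: (le_trans (m_le _ (r * t) (mulr_ge0 (ltW r0) t0))).
    rewrite rmorphM /= -scalerA -scalerDr sublinearZ // mulrBr mulrA; exact: lexx.
- by move=> x; have := m_le x 0 (lexx _); rewrite scale0r addr0 mul0r subr0.
- by move=> x; have := m_le x 1 ler01; rewrite scale1r mul1r.
Qed.

Theorem hahn_banach p : sublinear p ->
  exists f, [/\ forall x y, f (x + y) = f x + f y,
                forall r x, f (r%:C *: x) = r * f x
              & forall x, f x <= p x].
Proof.
move=> hp.
pose T := {q : V -> R | sublinear q /\ forall x, q x <= p x}.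
(* The order is reversed, so that Zorn's lemma returns a minimal functional. *)
pose rel_T (q q' : T) := `[< forall x, sval q' x <= sval q x >].
have pT : sublinear p /\ forall x, p x <= p x by split.
have [|||[q [hq qp]] qmin] := @ZL_preorder T (exist _ p pT) rel_T.
- by move=> q; apply/asboolP.
- move=> q1 q2 q3 /asboolP h1 /asboolP h2; apply/asboolP => x.
  exact: le_trans (h2 x) (h1 x).
- move=> F Ftot.
  have [[q0 Fq0]|F0] := pselect (F !=set0); last first.
    by exists (exist _ p pT) => q Fq; case: F0; exists q.
  have [|||m hm mP] := @inf_chain p [set sval q | q in F].
  + by exists (sval q0), q0.
  + by move=> _ [q _ <-]; exact: (svalP q).
  + move=> _ _ [q Fq <-] [q' Fq' <-].
    by case: (Ftot _ _ Fq Fq') => /asboolP; [left|right].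
  have mp x : m x <= p x.
    by apply: (le_trans (mP (sval q0) _ x)); [exists q0|case: (svalP q0)].
  exists (exist _ m (conj hm mp)) => q Fq; apply/asboolP => x /=.
  by apply: mP; exists q.
have [qD qZ] := hq.
have qadd x y : q (x + y) = q x + q y.
  apply/le_anti; rewrite qD /=.
  have [q' [hq' q'q q'y]] := sublinear_shift y hq.
  have q'p z : q' z <= p z by exact: le_trans (q'q z) (qp z).
  have := qmin (exist _ q' (conj hq' q'p)) => /(_ _)/asboolP h.
  have := h (introT (asboolP _) q'q) x; have := q'y x; rewrite /=; lra.
have qN x : q (- x) = - q x.
  by have := qadd x (- x); rewrite subrr sublinear0 //; lra.
exists q; split=> // r x.
have [r0|r0|->] := ltrgt0P r.
- by rewrite sublinearZ.
- rewrite -[r]opprK rmorphN scaleNr qN sublinearZ ?oppr_gt0 //; lra.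
- by rewrite scale0r mul0r sublinear0.
Qed.

End HahnBanach.

(** * States *)

Section States.
Variables (R : realType) (A : cstarAlgType R) (B : set A).
Hypothesis B_subalg : unital_cstar_subalgebra B.
Implicit Types (x y h : A) (k : R[i]).

Lemma cartesian x : B x -> exists a b,
  [/\ B a /\ B b, star a = a, star b = b & x = a + 'i%C *: b].
Proof.
move=> Bx; have Bsx := subalg_star B_subalg Bx.
exists ((2^-1)%:C *: (x + star x)), ((2^-1)%:C *: ('i%C *: (star x - x))).
split.
- by split; do ?apply: subalgZ => //; [apply: subalgD|apply: subalgB].
- by rewrite starZr starD starK addrC.
- by rewrite starZr starZ starB starK conj_i scaleNr -scalerN opprB.
- rewrite [in X in _ + X]scalerA mulrC -scalerA [in X in _ + _ *: X]scalerA mulC_ii.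
  rewrite scaleN1r -scalerDr -[LHS](scale_half_double x); congr (_ *: _); noncomm.
Qed.

Variable f : A -> R[i].
Hypothesis f_state : state_on B f.

Lemma stateD x y : B x -> B y -> f (x + y) = f x + f y.
Proof.
by move=> Bx By; have [/(_ 1 x y Bx By)] := f_state; rewrite scale1r mul1r.
Qed.
Lemma state0 : f 0 = 0.
Proof.
have B0 := subalg0 B_subalg.
by apply: (addrI (f 0)); rewrite -stateD // !addr0.
Qed.
Lemma stateZ k x : B x -> f (k *: x) = k * f x.
Proof.
have B0 := subalg0 B_subalg.
by move=> Bx; have [/(_ k x 0 Bx B0)] := f_state; rewrite state0 !addr0.
Qed.
Lemma stateN x : B x -> f (- x) = - f x.
Proof. by move=> Bx; rewrite -scaleN1r stateZ // mulN1r. Qed.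
Lemma stateB x y : B x -> B y -> f (x - y) = f x - f y.
Proof.
move=> Bx By; rewrite stateD //; last exact: subalgN.
by rewrite stateN.
Qed.

(** The square root stays in B, so positivity in the ambient algebra can be tested by a state on
    B. *)
Lemma state_pos h : B h -> pos h -> 0 <= f h.
Proof.
move=> Bh h0; have [s [Bs s_sa <- _ _]] := pos_sqrt B_subalg Bh h0.
by rewrite -{1}s_sa; have [_ + _] := f_state; apply.
Qed.

(** A self-adjoint [h] is the difference of the positive elements [nm h] and [nm h - h]. *)
Lemma state_sa_real h : B h -> star h = h -> f h \is Num.real.
Proof.
move=> Bh h_sa; have B1 := subalg1 B_subalg.
have Bt : B ((nm h)%:C *: 1) by exact: subalgZ.
rewrite -(subKr ((nm h)%:C *: 1) h) stateB //; last exact: subalgB.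
apply: rpredB; apply: ger0_real; apply: state_pos => //.
- by apply: posZ; [exact: nm_ge0|exact: pos1].
- exact: subalgB.
- exact: sa_pos.
Qed.

Lemma state_star x : B x -> f (star x) = Num.conj (f x).
Proof.
move=> /cartesian[a [b [[Ba Bb] a_sa b_sa ->]]].
have Bib : B ('i%C *: b) by exact: subalgZ.
rewrite starD starZ a_sa b_sa conj_i scaleNr stateB // stateD // stateZ //.
have /CrealP fa := state_sa_real Ba a_sa.
have /CrealP fb := state_sa_real Bb b_sa.
by rewrite rmorphD rmorphM /= fa fb conj_i mulNr.
Qed.

End States.

(** * Elements with positive real part, and the span of the unitaries *)

Section Accretive.
Variables (R : realType) (A : cstarAlgType R).
Implicit Types (x y : A) (r : R).

(** Elements such as [b - sigma b] need not be self-adjoint, so the order is imposed on real parts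
    only. *)
Definition acc x := pos (x + star x).

Lemma acc_pos x : pos x -> acc x.
Proof. by move=> x0; apply: posD; rewrite ?pos_sa. Qed.

Lemma accD x y : acc x -> acc y -> acc (x + y).
Proof.
move=> ax ay; rewrite /acc starD addrACA; exact: posD.
Qed.

Lemma accZ r x : 0 <= r -> acc x -> acc (r%:C *: x).
Proof. by move=> r0 ax; rewrite /acc starZr -scalerDr; exact: posZ. Qed.

Lemma acc_scalar r : 0 <= r -> acc (r%:C *: 1).
Proof. by move=> r0; apply/acc_pos/posZ => //; exact: pos1. Qed.

Lemma acc_nm x : acc ((nm x)%:C *: 1 - x).
Proof.
rewrite /acc starB starZr star1.
have -> : (nm x)%:C *: 1 - x + ((nm x)%:C *: 1 - star x) =
    (nm x + nm x)%:C *: 1 - (x + star x).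
  by rewrite -scalerDC; noncomm.
apply: sa_pos; first by rewrite starD starK addrC.
by have := nmD x (star x); rewrite nm_star.
Qed.

Lemma state_acc (B : set A) f x : unital_cstar_subalgebra B -> state_on B f ->
  B x -> acc x -> 0 <= complex.Re (f x).
Proof.
move=> HB Hf Bx ax; have Bsx := subalg_star HB Bx.
have := state_pos HB Hf (subalgD HB Bx Bsx) ax.
rewrite (stateD Hf) // (state_star HB Hf) //.
case: (f x) => a b; rewrite -[Num.conj _]/(a -i* b)%C => /=.
by rewrite lecE /= => /andP[_]; lra.
Qed.

(** A self-adjoint contraction [h] is the mean of [u] and [star u] for the unitary
    [u = h + i sqrt (1 - h^2)]; scaling and the Cartesian decomposition reach all of C. *)
Lemma unitary_span_ind (C : set A) (P : A -> Prop) :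
  unital_cstar_subalgebra C ->
  (forall k x y, P x -> P y -> P (k *: x + y)) ->
  (forall u, C u -> star u * u = 1 -> u * star u = 1 -> P u) ->
  forall c, C c -> P c.
Proof.
move=> HC Plin Pu c Cc.
have P1 : P 1 by apply: Pu; rewrite ?star1 ?mulr1 //; exact: subalg1.
have P0 : P 0 by have := Plin (-1) 1 1 P1 P1; rewrite scaleN1r addNr.
have PZ k x : P x -> P (k *: x) by move=> Px; rewrite -[_ *: _]addr0; exact: Plin.
have Pball h : C h -> star h = h -> nm h <= 1 -> P h.
  move=> Ch h_sa h1.
  have C1 := subalg1 HC; have Chh := subalgM HC Ch Ch.
  have p1 : pos (1 - h * h).
    have := @sa_pos _ _ (h * h) 1; rewrite scale1r; apply.
      by rewrite starM h_sa.
    by rewrite nm_sa_sqr // expr_le1 ?nm_ge0.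
  have [w [Cw w_sa wE _ wc]] := pos_sqrt HC (subalgB HC C1 Chh) p1.
  have wh : w * h = h * w by apply: wc; rewrite mulrBl mulrBr mul1r mulr1 mulrA.
  pose u := h + 'i%C *: w.
  have uE : star u = h - 'i%C *: w.
    by rewrite /u starD h_sa starZ conj_i w_sa scaleNr.
  have su_u : star u * u = 1.
    rewrite uE /u mulrDl !mulrDr !mulNr -!scalerAl -!scalerAr scalerA mulC_ii.
    by rewrite scaleN1r opprK wh wE; noncomm.
  have u_su : u * star u = 1.
    rewrite uE /u mulrDl !mulrDr !mulrN -!scalerAl -!scalerAr scalerA mulC_ii.
    by rewrite scaleN1r opprK wh wE; noncomm.
  have Cu : C u by apply: subalgD => //; exact: subalgZ.
  have <- : (2^-1)%:C *: (u + star u) = h.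
    by rewrite -[RHS](scale_half_double h) uE /u; congr (_ *: _); noncomm.
  apply: PZ; rewrite -{1}(scale1r u); apply: Plin; apply: Pu; rewrite ?starK //.
  exact: subalg_star.
have Psa h : C h -> star h = h -> P h.
  (* Dividing by [nm h + 1] rather than [nm h] covers [h = 0] too. *)
  move=> Ch h_sa; have n0 : 0 < nm h + 1 by have := nm_ge0 h; lra.
  have -> : h = (nm h + 1)%:C *: ((nm h + 1)^-1%:C *: h).
    by rewrite scalerAC divff ?gt_eqF // scale1r.
  apply: PZ; apply: Pball.
  - exact: subalgZ.
  - by rewrite starZr h_sa.
  - by rewrite nmZr ger0_norm ?invr_ge0 ?(ltW n0) // mulrC ler_pdivrMr //; lra.
have [a [b [[Ca Cb] a_sa b_sa ->]]] := cartesian HC Cc.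
by rewrite addrC; apply: Plin; exact: Psa.
Qed.

End Accretive.

(** * Markov-Kakutani averaging *)

Section Averaging.
Variables (R : realType) (A : cstarAlgType R) (C : set A) (mu : A -> R[i]).
Hypothesis C_subalg : unital_cstar_subalgebra C.
Hypothesis C_comm : commutative_subset C.
Hypothesis mu_state : state_on C mu.
Implicit Types (x y b c u : A) (T : A -> A) (e : R).

(** Shared by [sigma] and the maps [Ad u], and closed under composition and Cesaro means: averages
    of both kinds can be chained while the values of [mu] on C stay fixed. *)
Definition markov_map T :=
  [/\ linear T, T 1 = 1, forall x, acc x -> acc (T x)
    & forall c, C c -> C (T c) /\ mu (T c) = mu c].

Section LinearMap.
Variable T : A -> A.
Hypothesis T_lin : linear T.
Lemma linmapD x y : T (x + y) = T x + T y.
Proof. by have := T_lin 1 x y; rewrite !scale1r. Qed.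
Lemma linmap0 : T 0 = 0.
Proof. by apply: (addrI (T 0)); rewrite -linmapD !addr0. Qed.
Lemma linmapZ k x : T (k *: x) = k *: T x.
Proof. by have := T_lin k x 0; rewrite linmap0 !addr0. Qed.
Lemma linmapN x : T (- x) = - T x.
Proof. by rewrite -scaleN1r linmapZ scaleN1r. Qed.
Lemma linmapB x y : T (x - y) = T x - T y.
Proof. by rewrite linmapD linmapN. Qed.
End LinearMap.

Lemma markov_id : markov_map id.
Proof. by split. Qed.

Lemma markov_comp T T' : markov_map T -> markov_map T' -> markov_map (T \o T').
Proof.
move=> [Tl T1 Ta Tc] [Tl' T1' Ta' Tc']; split=> /=.
- by move=> k x y; rewrite /= Tl' Tl.
- by rewrite T1' T1.
- by move=> x /Ta'/Ta.
- by move=> c Cc; have [/Tc[? ->] ?] := Tc' _ Cc.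
Qed.

Lemma markov_iter n T : markov_map T -> markov_map (iter n T).
Proof.
by move=> MT; elim: n => [|n IH]; [exact: markov_id|exact: markov_comp MT IH].
Qed.

Lemma markov_pos T e x : markov_map T -> acc (e%:C *: 1 - x) ->
  acc (e%:C *: 1 - T x).
Proof.
move=> [Tl T1 Ta _] /Ta; rewrite linmapB // linmapZ // T1; exact.
Qed.

Definition cesaro n T x : A :=
  (n.+1%:R^-1)%:C *: \sum_(k < n.+1) iter k T x.

Lemma cesaro_linear n T : linear T -> linear (cesaro n T).
Proof.
move=> Tl k x y; rewrite /cesaro.
have iterl i : linear (iter i T).
  by elim: i => [//|i IH] k' x' y' /=; rewrite IH Tl.
under eq_bigr => i _ do rewrite iterl.
rewrite big_split /= scalerDr -scaler_sumr; congr (_ + _).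
by rewrite !scalerA mulrC.
Qed.

Lemma cesaro_fix n T x : T x = x -> cesaro n T x = x.
Proof.
move=> Tx; rewrite /cesaro (eq_bigr (fun=> x)).
  rewrite sumr_const card_ord -(scaler_nat _ x) scalerA.
  rewrite -(rmorph_nat (real_complex R) n.+1) -rmorphM mulVf ?scale1r //.
by move=> i _; elim: (val i) => //= m ->.
Qed.

Lemma markov_cesaro n T : markov_map T -> markov_map (cesaro n T).
Proof.
move=> MT; have [Tl T1 Ta Tc] := MT; split.
- exact: cesaro_linear.
- exact: cesaro_fix.
- move=> x ax; apply: accZ; first by rewrite invr_ge0 ler0n.
  apply: (big_ind (@acc R A)); first by apply/acc_pos/pos0.
    exact: accD.
  by move=> i _; have [_ _ + _] := markov_iter i MT; apply.
- move=> c Cc.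
  have Citer i : C (iter i T c) by have [_ _ _ /(_ _ Cc)[]] := markov_iter i MT.
  have CS m : C (\sum_(k < m) iter k T c).
    by apply: (subalg_sum C_subalg) => i _.
  split; first by apply: subalgZ.
  rewrite (stateZ C_subalg mu_state) //.
  have muS m : mu (\sum_(k < m) iter k T c) = m%:R * mu c.
    elim: m => [|m IH]; first by rewrite big_ord0 mul0r (state0 C_subalg mu_state).
    rewrite big_ord_recr /= (stateD mu_state) //; last exact: CS.
    rewrite [X in X + _](_ : _ = m%:R * mu c) //.
    have [_ _ _ /(_ _ Cc)[_ ->]] := markov_iter m MT.
    by rewrite -natr1 mulrDl mul1r.
  by rewrite muS mulrA -(rmorph_nat (real_complex R) n.+1) -rmorphM mulVf ?mul1r //.
Qed.

Lemma cesaro_coboundary n T b : linear T ->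
  cesaro n T (b - T b) = (n.+1%:R^-1)%:C *: (b - iter n.+1 T b).
Proof.
move=> Tl; congr (_ *: _).
have iterl i : linear (iter i T).
  by elim: i => [//|i IH] k' x' y' /=; rewrite IH Tl.
elim: n.+1 => [|m IH]; first by rewrite big_ord0 subrr.
rewrite big_ord_recr /= IH linmapB // -iterSr /=.
by rewrite addrA subrK.
Qed.

(** The mean telescopes to [(b - T^(n+1) b) / (n+1)]. Its real part is at most [2 nm b / (n+1)],
    because T preserves upper bounds by scalars. *)
Lemma cesaro_coboundary_small T b e : markov_map T -> 0 < e ->
  exists n, acc (e%:C *: 1 - cesaro n T (b - T b)).
Proof.
move=> MT e0; have [Tl T1 Ta _] := MT; set t := nm b.
have [n Hn] : exists n, 2 * t / e < n.+1%:R.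
  exists (Num.truncn (2 * t / e)); exact: truncnS_gt.
exists n; rewrite cesaro_coboundary //.
set N := iter n.+1 T b.
have aN : acc (t%:C *: 1 - (- N)).
  have := acc_nm (- b); rewrite nmN => /(markov_pos (markov_iter n.+1 MT)).
  have [Tnl _ _ _] := markov_iter n.+1 MT.
  by rewrite (linmapN Tnl).
have := accD (acc_nm b) aN.
have n0 : 0 <= n.+1%:R^-1 :> R by rewrite invr_ge0 ler0n.
move=> /(accZ n0) h.
have -> : e%:C *: 1 - n.+1%:R^-1%:C *: (b - N) =
    (e - n.+1%:R^-1 * (t + t))%:C *: 1 +
      n.+1%:R^-1%:C *: (t%:C *: 1 - b + (t%:C *: 1 - - N)).
  have -> : t%:C *: 1 - b + (t%:C *: 1 - - N) = (t + t)%:C *: 1 - (b - N).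
    by rewrite -scalerDC; noncomm.
  by rewrite [in RHS]scalerBr scalerAC addrA scalerDC subrK.
apply: accD => //; apply: acc_scalar; rewrite subr_ge0.
rewrite ler_pdivrMl ?ltr0Sn // mulrC.
by move: Hn; rewrite ltr_pdivrMr // => /ltW; rewrite mulrC; lra.
Qed.

Definition unitary_in u := [/\ C u, star u * u = 1 & u * star u = 1].

Definition Ad u x := u * x * star u.

Lemma Ad_linear u : linear (Ad u).
Proof.
by move=> k x y; rewrite /Ad mulrDr mulrDl -scalerAr -scalerAl.
Qed.

Lemma Ad_star u x : star (Ad u x) = Ad u (star x).
Proof. by rewrite /Ad !starM starK mulrA. Qed.

Lemma Ad_fix u c : unitary_in u -> C c -> Ad u c = c.
Proof.
by move=> [Cu _ uu] Cc; rewrite /Ad (C_comm Cu Cc) -mulrA uu mulr1.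
Qed.

Lemma Ad_comm u v x : C u -> C v -> Ad u (Ad v x) = Ad v (Ad u x).
Proof.
move=> Cu Cv; rewrite /Ad !mulrA (C_comm Cu Cv) -!mulrA.
by rewrite (C_comm (subalg_star C_subalg Cv) (subalg_star C_subalg Cu)).
Qed.

Lemma markov_Ad u : unitary_in u -> markov_map (Ad u).
Proof.
move=> Uu; split.
- exact: Ad_linear.
- by apply: Ad_fix => //; exact: subalg1.
- move=> x ax; rewrite /acc Ad_star -(linmapD (Ad_linear u)).
  by rewrite /Ad -{1}(starK u); exact: pos_conj.
- by move=> c Cc; rewrite Ad_fix.
Qed.

(** Finite sums of terms [Ad u b - b], in a form where induction removes one generator at a time. *)
Inductive comm_null : A -> Prop :=
| comm_null0 : comm_null 0
| comm_null_cons u b x :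
    unitary_in u -> comm_null x -> comm_null (Ad u b - b + x).

Lemma comm_nullD x y : comm_null x -> comm_null y -> comm_null (x + y).
Proof.
move=> nx ny; elim: nx => [|u b z Uu _ IH]; first by rewrite add0r.
by rewrite -addrA; exact: comm_null_cons.
Qed.

(** The unitary may change: for [sigma] it becomes [sigma u]. *)
Lemma comm_null_map T x : linear T ->
  (forall u b, unitary_in u -> exists2 v, unitary_in v & T (Ad u b) = Ad v (T b)) ->
  comm_null x -> comm_null (T x).
Proof.
move=> Tl TAd; elim=> [|u b z Uu _ IH]; first by rewrite linmap0 //; exact: comm_null0.
rewrite linmapD // linmapB //; have [v Uv ->] := TAd u b Uu.
exact: comm_null_cons.
Qed.

(* The Ad u commute, so the mean that makes one generator of x small leaves the
   remaining ones of the same form. *)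
Lemma comm_null_small x : comm_null x -> forall T, markov_map T ->
  (forall u y, unitary_in u -> T (Ad u y) = Ad u (T y)) ->
  forall e, 0 < e -> exists2 T', markov_map T' & acc (e%:C *: 1 - T' (T x)).
Proof.
elim=> [|u b z Uu _ IH] T MT TAd e e0.
  exists id; first exact: markov_id.
  have [Tl _ _ _] := MT; rewrite linmap0 // subr0.
  exact/acc_scalar/ltW.
have e2 : 0 < e / 2 by lra.
have MAd := markov_Ad Uu; have [Adl _ _ _] := MAd.
(* The sign turns the coboundary [b' - Ad u b'] at [b' = - T b] into [Ad u (T b) - T b], the image
   of the first generator. *)
have [n Hn] := cesaro_coboundary_small (- T b) MAd e2.
set S := cesaro n (Ad u) in Hn.
have MS : markov_map S := markov_cesaro n MAd.
have [|v y Uv|T' MT' HT'] := IH (S \o T) _ _ _ e2.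
- exact: markov_comp.
- rewrite /= TAd // /S /cesaro.
  have [Adlv _ _ _] := markov_Ad Uv.
  rewrite linmapZ //; congr (_ *: _).
  rewrite (big_morph (Ad v) (linmapD Adlv) (linmap0 Adlv)).
  apply: eq_bigr => i _; elim: (val i) => //= m ->.
  by case: Uu Uv => Cu _ _ [Cv _ _]; rewrite Ad_comm.
exists (T' \o S); first exact: markov_comp.
have [Tl _ _ _] := MT; have [Sl _ _ _] := MS; have [Tl' _ _ _] := MT'.
have h1 := markov_pos MT' Hn.
have := accD h1 HT'; congr acc.
rewrite /= (linmapD Tl) (linmapB Tl) (TAd _ _ Uu).
have -> : - T b - Ad u (- T b) = Ad u (T b) - T b.
  by rewrite (linmapN Adl) opprK addrC.
rewrite (linmapD Sl (_ - _)) (linmapD Tl').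
by rewrite [e in RHS]splitr -scalerDC; noncomm.
Qed.

Variable sigma : A -> A.
Hypothesis sigma_markov : markov_map sigma.
Hypothesis sigma_Ad : forall u b, unitary_in u ->
  exists2 v, unitary_in v & sigma (Ad u b) = Ad v (sigma b).

Lemma comm_nullZ k x : comm_null x -> comm_null (k *: x).
Proof.
apply: (comm_null_map (T := fun y => k *: y)).
  by move=> l y z; rewrite scalerDr !scalerA mulrC.
by move=> u b Uu; exists u => //; rewrite linmapZ //; exact: Ad_linear.
Qed.

Lemma comm_null_cesaro n x : comm_null x -> comm_null (cesaro n sigma x).
Proof.
move=> nx; apply: comm_nullZ.
apply: (big_ind comm_null); [exact: comm_null0|exact: comm_nullD|].
move=> i _; elim: (val i) => //= m IH.
by have [sl _ _ _] := sigma_markov; exact: comm_null_map.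
Qed.

(** This is [p 0 >= 0]. A mean of [sigma] makes [b - sigma b] small and keeps [x] in [comm_null]; a
    second averaging makes the image of [x] small. What remains is the average of [c] plus [e], on
    which [mu] is [mu c + e]. *)
Lemma invariant_pos c b x : C c -> comm_null x ->
  acc (c + (b - sigma b) + x) -> 0 <= complex.Re (mu c).
Proof.
move=> Cc nx ax; apply/ler_addgt0Pr => e e0.
have e2 : 0 < e / 2 by lra.
have [n Hn] := cesaro_coboundary_small b sigma_markov e2.
have MS := markov_cesaro n sigma_markov.
have [T MT HT] := comm_null_small (comm_null_cesaro n nx) markov_id
  (fun _ _ _ => erefl) e2.
have [Sl _ Sa Sc] := MS; have [Tl _ Ta Tc] := MT.
have aTS := Ta _ (Sa _ ax).
have h1 := markov_pos MT Hn.
have := accD (accD aTS h1) HT.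
have -> : T (cesaro n sigma (c + (b - sigma b) + x)) +
     ((e / 2)%:C *: 1 - T (cesaro n sigma (b - sigma b))) +
     ((e / 2)%:C *: 1 - T (id (cesaro n sigma x))) =
     e%:C *: 1 + T (cesaro n sigma c).
  rewrite !(linmapD Sl) !(linmapD Tl) /=.
  by rewrite [e in RHS]splitr -scalerDC; noncomm.
have [CSc muSc] := Sc _ Cc; have [CTSc muTSc] := Tc _ CSc.
have C1 := subalg1 C_subalg; have Ce := subalgZ C_subalg e%:C C1.
move=> /(state_acc C_subalg mu_state (subalgD C_subalg Ce CTSc)).
rewrite (stateD mu_state) // (stateZ C_subalg mu_state) // muTSc muSc.
have [_ _ ->] := mu_state; rewrite mulr1.
by case: (mu c) => u v /=; lra.
Qed.

End Averaging.

(** * Existence of the invariant extension *)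

Section CompletelyPositive.
Variables (R : realType) (A : cstarAlgType R) (T : {linear A -> A}).
Hypothesis T_cp : completely_positive setT setT T.
Hypothesis T1 : T 1 = 1.
Implicit Types x h : A.

(** Complete positivity on matrices of size 1. *)
Lemma cp_pos h : pos h -> pos (T h).
Proof.
move=> [s [s_sa hE]].
have [] := T_cp (n := 1) (P := const_mx h).
  exists (const_mx s); split=> //; apply/matrixP => i j.
  by rewrite !mxE big_ord1 !mxE s_sa.
move=> X [_ /matrixP/(_ 0 0)]; rewrite !mxE big_ord1 !mxE => ->.
exact: pos_starM.
Qed.

(** For self-adjoint [h], the image of the positive [nm h - h] is self-adjoint, and [T 1 = 1]
    removes the scalar. *)
Lemma cp_star x : T (star x) = star (T x).
Proof.
have T_sa h : star h = h -> star (T h) = T h.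
  move=> h_sa; have := cp_pos (sa_pos h_sa (lexx _)).
  rewrite linearB linearZ /= T1 => /pos_sa.
  by rewrite starB starZr star1 => /addrI/oppr_inj.
have [a [b [_ a_sa b_sa ->]]] := cartesian (unital_cstar_subalgebraT A) (I : setT x).
rewrite starD starZ a_sa b_sa conj_i !linearD !linearZ /= starD starZ conj_i.
by rewrite !T_sa.
Qed.

Lemma cp_acc x : acc x -> acc (T x).
Proof. by rewrite /acc -cp_star -linearD; exact: cp_pos. Qed.

End CompletelyPositive.

Section Existence.
Variables (R : realType) (A : cstarAlgType R) (sigma : {linear A -> A}).
Variables (C : set A) (mu : A -> R[i]).
Hypothesis sigma1 : sigma 1 = 1.
Hypothesis sigma_cp : completely_positive setT setT sigma.
Hypothesis C_subalg : unital_cstar_subalgebra C.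
Hypothesis C_stable : forall c, C c -> C (sigma c).
Hypothesis C_comm : commutative_subset C.
Hypothesis sigma_mul : forall c a : A, C c -> sigma (c * a) = sigma c * sigma a.
Hypothesis mu_state : state_on C mu.
Hypothesis mu_inv : forall c, C c -> mu (sigma c) = mu c.
Implicit Types (a b c x : A) (r : R).

Let sigma_markov : markov_map C mu sigma.
Proof.
split=> //.
- by move=> k x y; rewrite linearP.
- exact: cp_acc.
- by move=> c Cc; split; [exact: C_stable|exact: mu_inv].
Qed.

(** Left multiplicativity over C, combined with adjoints, yields right multiplicativity, and it
    makes [sigma u] unitary. *)
Let sigma_Ad u b : unitary_in C u ->
  exists2 v, unitary_in C v & sigma (Ad u b) = Ad v (sigma b).
Proof.
move=> [Cu uu uu']; have Csu := subalg_star C_subalg Cu.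
exists (sigma u).
  split; first exact: C_stable.
    by rewrite -(cp_star sigma_cp sigma1) -sigma_mul // uu.
  by rewrite -(cp_star sigma_cp sigma1) -sigma_mul // uu'.
rewrite /Ad -mulrA sigma_mul // -mulrA; congr (_ * _).
rewrite -{1}(starK b) -starM (cp_star sigma_cp sigma1) sigma_mul //.
by rewrite starM (cp_star sigma_cp sigma1 b) starK.
Qed.

Let upper a : set R := [set r | exists c b x,
  [/\ C c, comm_null C x, acc (c + (b - sigma b) + x - a) & r = complex.Re (mu c)]].

(** The scalar [nm a] is a competitor. For the lower bound, adding the accretive [nm a + a] cancels
    [a], and [invariant_pos] applies to [c + nm a]. *)
Let upper_has_inf a : has_inf (upper a).
Proof.
split.
  exists (complex.Re (mu ((nm a)%:C *: 1))), ((nm a)%:C *: 1), 0, 0; split=> //.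
  - by apply: subalgZ => //; exact: subalg1.
  - exact: comm_null0.
  - by rewrite linear0 subr0 !addr0; exact: acc_nm.
exists (- nm a) => r [c [b [x [Cc nx ax ->]]]].
have Ct : C ((nm a)%:C *: 1) by apply: subalgZ => //; exact: subalg1.
have := accD ax (acc_nm (- a)); rewrite nmN.
have -> : c + (b - sigma b) + x - a + ((nm a)%:C *: 1 - - a) =
  c + (nm a)%:C *: 1 + (b - sigma b) + x by noncomm.
move=> /(invariant_pos C_subalg C_comm mu_state sigma_markov sigma_Ad
  (subalgD C_subalg Cc Ct) nx).
rewrite (stateD mu_state) // (stateZ C_subalg mu_state); last exact: subalg1.
by have [_ _ ->] := mu_state; rewrite mulr1; case: (mu c) => u v /=; lra.
Qed.

Let p a := inf (upper a).

Let p_le a c b x : C c -> comm_null C x -> acc (c + (b - sigma b) + x - a) ->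
  p a <= complex.Re (mu c).
Proof.
move=> Cc nx ax; apply: ge_inf; first by case: (upper_has_inf a).
by exists c, b, x.
Qed.

Let p_sublinear : sublinear p.
Proof.
have le_p a (u : R) : (forall r, upper a r -> u <= r) -> u <= p a.
  by move=> ur; apply: lb_le_inf => //; case: (upper_has_inf a).
split=> [a a'|r a r0].
- rewrite -lerBlDr; apply: (le_p) => _ [c [b [x [Cc nx ax ->]]]].
  rewrite lerBlDr -lerBlDl; apply: (le_p) => _ [c' [b' [x' [Cc' nx' ax' ->]]]].
  rewrite lerBlDl -raddfD -(stateD mu_state) //.
  apply: (@p_le _ (c + c') (b + b') (x + x')).
  + exact: subalgD.
  + exact: comm_nullD.
  + have := accD ax ax'; congr acc; rewrite linearD; noncomm.
- rewrite -ler_pdivrMl //; apply: (le_p) => _ [c [b [x [Cc nx ax ->]]]].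
  rewrite ler_pdivrMl //.
  have -> : r * complex.Re (mu c) = complex.Re (mu (r%:C *: c)).
    by rewrite (stateZ C_subalg mu_state) //; case: (mu c) => u v /=; lra.
  apply: (@p_le _ _ (r%:C *: b) (r%:C *: x)).
  + exact: subalgZ.
  + exact: comm_nullZ.
  + by rewrite linearZ -!scalerBr -!scalerDr -scalerBr; exact: accZ (ltW r0) _.
Qed.

Lemma invariant_extension : exists phi : A -> R[i],
  [/\ state_on setT phi,
      forall c, C c -> phi c = mu c,
      forall a, phi (sigma a) = phi a
    & forall c a, C c -> phi (c * a) = phi (a * c)].
Proof.
have [f [fD fZ fp]] := hahn_banach p_sublinear.
have fN a : f (- a) = - f a.
  by have := fZ (-1) a; rewrite rmorphN rmorph1 scaleN1r mulN1r.
have C0 := subalg0 C_subalg.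
(* Here [c = 0] is a competitor for [a]. *)
have f_acc b x a : comm_null C x -> acc ((b - sigma b) + x - a) -> f a <= 0.
  move=> nx ax; apply: (le_trans (fp a)).
  have := @p_le a 0 b x C0 nx; rewrite add0r (state0 C_subalg mu_state); exact.
have acc0 : acc (0 : A) by exact/acc_pos/pos0.
(* The elements [b - sigma b + x] are closed under negation, so the one-sided bound gives
   equality. *)
have f_null b x : comm_null C x -> f ((b - sigma b) + x) = 0.
  have le0 b' x' : comm_null C x' -> f ((b' - sigma b') + x') <= 0.
    by move=> nx; apply: (f_acc b' x') => //; rewrite subrr.
  move=> nx; apply/le_anti; rewrite le0 //= -oppr_le0 -fN.
  have -> : - (b - sigma b + x) = (- b - sigma (- b)) + (- 1) *: x.
    by rewrite linearN scaleN1r; noncomm.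
  by apply: le0; exact: comm_nullZ.
have fsigma a : f (sigma a) = f a.
  have := f_null a 0 (comm_null0 C); rewrite addr0 fD fN => /eqP.
  by rewrite subr_eq0 => /eqP.
have fAd u a : unitary_in C u -> f (Ad u a) = f a.
  move=> Uu; have := f_null 0 _ (comm_null_cons a Uu (comm_null0 C)).
  rewrite linear0 subr0 add0r addr0 fD fN => /eqP.
  by rewrite subr_eq0 => /eqP.
have f_ge0 a : acc a -> 0 <= f a.
  move=> aa; rewrite -oppr_le0 -fN; apply: (f_acc 0 0); first exact: comm_null0.
  by rewrite linear0 !subr0 addr0 opprK add0r.
(* Both [a] and [- a] are accretive. This will make [phi] real on positive elements. *)
have f_skew a : a + star a = 0 -> f a = 0.
  move=> a0; apply/le_anti; rewrite f_ge0 ?/acc ?a0; last exact: pos0.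
  rewrite andbT -oppr_ge0 -fN f_ge0 // /acc starN -opprD a0 oppr0; exact: pos0.
(* [c] competes for itself, which gives one inequality; [- c] gives the other. *)
have fmu c : C c -> f c = complex.Re (mu c).
  have le c' : C c' -> f c' <= complex.Re (mu c').
    move=> Cc; apply: (le_trans (fp c')); apply: (@p_le _ _ 0 0 Cc).
      exact: comm_null0.
    by rewrite linear0 !addr0 subr0 addr0 subrr.
  move=> Cc; apply/le_anti; rewrite le //= -lerN2 -fN.
  apply: (le_trans (le _ (subalgN C_subalg Cc))).
  by rewrite (stateN C_subalg mu_state) //; case: (mu c) => u v /=.
(* The complex linear functional with real part [f]. *)
pose phi a : R[i] := (f a -i* f ('i%C *: a))%C.
have phi_lin k a a' : phi (k *: a + a') = k * phi a + phi a'.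
  have kE (l : R[i]) z : f (l *: z) = complex.Re l * f z + complex.Im l * f ('i%C *: z).
    by rewrite {1}[l]complexE scalerDl fD fZ ['i%C * _]mulrC -scalerA fZ.
  rewrite /phi scalerDr scalerA !fD (kE k) (kE ('i%C * k)).
  case: k => u v; apply/eqP; rewrite eq_complex /=.
  by apply/andP; split; apply/eqP; ring.
have phi_pos h : pos h -> 0 <= phi h.
  move=> h0; rewrite /phi lecE /= f_ge0 ?andbT; last exact: acc_pos.
  rewrite f_skew ?oppr0 ?eqxx //.
  by rewrite starZ conj_i scaleNr pos_sa // subrr.
have phi_mu c : C c -> phi c = mu c.
  move=> Cc; rewrite /phi !fmu //; last exact: subalgZ.
  rewrite (stateZ C_subalg mu_state) //; case: (mu c) => u v.
  by apply/eqP; rewrite eq_complex /=; apply/andP; split; apply/eqP; ring.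
exists phi; split=> //.
- split=> [k x y _ _|x _|]; [exact: phi_lin|exact/phi_pos/pos_starM|].
  by rewrite phi_mu; [case: mu_state|exact: subalg1].
- by move=> a; rewrite /phi fsigma -linearZ fsigma.
move=> c a Cc; move: c Cc a.
apply: (unitary_span_ind (P := fun c => forall a, phi (c * a) = phi (a * c))) => //.
  move=> k x y Hx Hy a.
  by rewrite mulrDl mulrDr -scalerAl -scalerAr !phi_lin Hx Hy.
move=> u Cu uu uu' a; have Uu : unitary_in C u by [].
(* For a unitary [u], the trace property is invariance under [Ad u] evaluated at [a * u]. *)
have -> : u * a = Ad u (a * u) by rewrite /Ad -!mulrA uu' mulr1.
rewrite /phi fAd //; congr (_ -i* _)%C.
by rewrite -(linmapZ (Ad_linear u)) fAd.
Qed.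

End Existence.

(** * Minimal projections *)

Section MinimalProjections.
Variables (R : realType) (A : cstarAlgType R) (M : set A).
Hypothesis M_subalg : unital_cstar_subalgebra M.
Hypothesis M_comm : commutative_subset M.
Implicit Types (x y v m p : A).

Section Generators.
Variables (n : nat) (e : 'I_n -> A).
Hypothesis M_e : forall i, M (e i).
Hypothesis e_span : forall x, M x -> exists c : 'I_n -> R[i], x = \sum_(i < n) c i *: e i.

(** The N by n coefficient matrix has more rows than columns, hence a nonzero left kernel. *)
Lemma linear_dependence N (v : 'I_N -> A) : (n < N)%N -> (forall k, M (v k)) ->
  exists2 u : 'rV[R[i]]_N, u != 0 & \sum_k u 0 k *: v k = 0.
Proof.
move=> nN Mv.
have /choice[c cP] : forall k, exists c : 'I_n -> R[i], v k = \sum_(i < n) c i *: e i.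
  by move=> k; exact: e_span.
pose Cm : 'M[R[i]]_(N, n) := \matrix_(k, i) c k i.
have ker0 : kermx Cm != 0.
  rewrite kermx_eq0 /row_free neq_ltn; apply/orP; left.
  exact: leq_ltn_trans (rank_leq_col _) nN.
exists (nz_row (kermx Cm)); first by rewrite nz_row_eq0.
have /sub_kermxP uC := nz_row_sub (kermx Cm).
under eq_bigr => k _ do rewrite cP scaler_sumr.
rewrite exchange_big /= big1 // => i _.
under eq_bigr => k _ do rewrite scalerA.
rewrite -scaler_suml; have /rowP/(_ i) := uC.
rewrite !mxE (eq_bigr (fun k => nz_row (kermx Cm) 0 k * c k i)).
  by move=> ->; rewrite scale0r.
by move=> k _; rewrite mxE.
Qed.

Lemma subalg_horner x (q : {poly R[i]}) : M x -> M (horner_alg x q).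
Proof.
move=> Mx; elim/poly_ind: q => [|q c IH].
  by rewrite rmorph0; exact: subalg0.
rewrite rmorphD rmorphM /= horner_algX horner_algC.
apply: subalgD => //; first exact: subalgM.
by apply: subalgZ => //; exact: subalg1.
Qed.

Lemma annihilating_poly x : M x ->
  exists2 q : {poly R[i]}, q != 0 & horner_alg x q = 0.
Proof.
move=> Mx; have Mpow k : M (x ^+ k).
  elim: k => [|k IH]; first by rewrite expr0; exact: subalg1.
  by rewrite exprS; exact: subalgM.
have [|u u0 uE] := @linear_dependence n.+1 (fun k => x ^+ k) (ltnSn n).
  by move=> k; exact: Mpow.
exists (rVpoly u).
  by apply: contra u0 => /eqP q0; rewrite -[u]rVpolyK q0 linear0.
rewrite -uE /rVpoly poly_def raddf_sum /=; apply: eq_bigr => k _.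
rewrite linearZ /= rmorphXn /= horner_algX.
by rewrite valK mulr_algl.
Qed.

(** Split an annihilating polynomial of [x] into linear factors over [R[i]] and apply them to [v]
    one after the other: the last nonzero vector is an eigenvector. *)
Lemma eigenvector_step x v : M x -> M v -> v != 0 ->
  exists a, [/\ M a, a * v != 0 & exists l : R[i], x * (a * v) = l *: (a * v)].
Proof.
move=> Mx Mv v0; have [q q0 qx] := annihilating_poly Mx.
have [s qE] := closed_field_poly_normal q.
have prod0 : horner_alg x (\prod_(z <- s) ('X - z%:P)) = 0.
  have : lead_coef q *: horner_alg x (\prod_(z <- s) ('X - z%:P)) = 0.
    by move: qx; rewrite {1}qE linearZ /= mulr_algl.
  move/eqP; rewrite scaler_eq0 lead_coef_eq0 (negPf q0) /=.
  by move/eqP.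
have {prod0} : horner_alg x (\prod_(z <- s) ('X - z%:P)) * v = 0.
  by rewrite prod0 mul0r.
elim: s {qE} => [|z s IH].
  by rewrite big_nil rmorph1 mul1r => /eqP; rewrite (negPf v0).
rewrite big_cons rmorphM /= -mulrA.
set a := horner_alg x (\prod_(j <- s) ('X - j%:P)).
have [av0|av0] := eqVneq (a * v) 0; first by move=> _; exact: IH.
move=> H; exists a; split=> //; first exact: subalg_horner.
exists z; apply/eqP; rewrite -subr_eq0 -H rmorphB /= horner_algX horner_algC.
by rewrite mulrBl -scalerAl mul1r.
Qed.

(** The spanning elements are treated in turn; commutativity keeps the eigenvalue equations already
    obtained. *)
Lemma joint_eigenvector v : M v -> v != 0 ->
  exists a, [/\ M a, a * v != 0
    & forall m, M m -> exists l : R[i], m * (a * v) = l *: (a * v)].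
Proof.
move=> Mv v0.
have [a [Ma av0 aP]] : exists a, [/\ M a, a * v != 0 & forall i, i \in enum 'I_n ->
    exists l : R[i], e i * (a * v) = l *: (a * v)].
  elim: (enum 'I_n) => [|i s [a [Ma av0 aP]]].
    by exists 1; rewrite mul1r; split=> //; exact: subalg1.
  have [b [Mb bav0 [l lE]]] :=
    eigenvector_step (M_e i) (subalgM M_subalg Ma Mv) av0.
  exists (b * a); rewrite -mulrA; split=> //; first exact: subalgM.
  move=> j; rewrite inE => /predU1P[->|js]; first by exists l.
  have [l' l'E] := aP _ js; exists l'.
  by rewrite mulrA (M_comm (M_e j) Mb) -mulrA l'E -scalerAr.
exists a; split=> // m /e_span[c ->].
have /choice[l lP] : forall i, exists l : R[i], e i * (a * v) = l *: (a * v).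
  by move=> i; apply: aP; rewrite mem_enum.
exists (\sum_(i < n) c i * l i); rewrite mulr_suml scaler_suml.
by apply: eq_bigr => i _; rewrite -scalerAl lP scalerA.
Qed.

Definition minimal_projection p :=
  [/\ M p, star p = p, p * p = p, p != 0
    & forall m, M m -> exists l : R[i], m * p = l *: p].

(** For a joint eigenvector [w], so is [z = star w * w], and [z * z = c z] with [c] real and
    nonzero, so [z / c] is a projection. Being a multiple of [v], it is killed by whatever kills
    [v]. *)
Lemma minimal_projection_multiple v : M v -> v != 0 ->
  exists a, M a /\ minimal_projection (a * v).
Proof.
move=> Mv v0; have [a [Ma w0 wP]] := joint_eigenvector Mv v0.
set w := a * v in w0 wP; have Mw : M w by exact: subalgM.
have Msw := subalg_star M_subalg Mw.
set z := star w * w; have Mz : M z by exact: subalgM.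
have z_sa : star z = z by rewrite /z starM starK.
have z0 : z != 0 by apply: contra w0 => /eqP/starM_eq0 ->.
have zP m : M m -> exists l : R[i], m * z = l *: z.
  move=> Mm; have [l lE] := wP _ Mm; exists l.
  by rewrite /z mulrA (M_comm Mm Msw) -mulrA lE -scalerAr.
have [c zz] := zP _ Mz.
have c0 : c != 0.
  apply: contra z0 => /eqP c0; apply/eqP/starM_eq0.
  by rewrite z_sa zz c0 scale0r.
have c_real : Num.conj c = c.
  have := congr1 (@star R A) zz; rewrite starM starZ z_sa zz => /eqP.
  rewrite -subr_eq0 -scalerBl scaler_eq0 (negPf z0) orbF subr_eq0.
  by move/eqP.
exists (c^-1 *: (star w * a)); split.
  by apply: subalgZ => //; exact: subalgM.
have -> : c^-1 *: (star w * a) * v = c^-1 *: z.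
  by rewrite -scalerAl -mulrA.
split.
- exact: subalgZ.
- by rewrite starZ fmorphV /= c_real z_sa.
- by rewrite -scalerAl -scalerAr zz [c^-1 *: (c *: _)]scalerA mulVf // scale1r.
- by rewrite scaler_eq0 invr_eq0 negb_or c0.
- move=> m Mm; have [l lE] := zP _ Mm; exists l.
  by rewrite -scalerAr lE !scalerA mulrC.
Qed.

(** While the sum falls short of 1, a minimal projection among the multiples of [1 - sum] is
    orthogonal to the family and enlarges it. *)
Lemma minimal_projections_or k :
  (exists N (p : 'I_N -> A), [/\ forall i, minimal_projection (p i),
    forall i j, i != j -> p i * p j = 0 & \sum_i p i = 1]) \/
  (exists p : 'I_k -> A, (forall i, minimal_projection (p i)) /\
    forall i j, i != j -> p i * p j = 0).
Proof.
elim: k => [|k [IH|[p [pmin porth]]]]; [|by left|].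
  by right; exists (fun=> 0); split=> [[]|[]].
have [s1|s1] := eqVneq (\sum_i p i) 1; first by left; exists k, p.
have Mp i : M (p i) by case: (pmin i).
set v := 1 - \sum_i p i.
have Mv : M v.
  apply: subalgB => //; first exact: subalg1.
  by apply: subalg_sum.
have v0 : v != 0 by rewrite subr_eq0 eq_sym.
have [a [Ma amin]] := minimal_projection_multiple Mv v0.
have vp i : v * p i = 0.
  rewrite mulrBl mul1r mulr_suml (bigD1 i) //= big1 ?addr0.
    by case: (pmin i) => _ _ -> _ _; rewrite subrr.
  by move=> j ji; exact: porth.
have avp i : a * v * p i = 0 by rewrite -mulrA vp mulr0.
have Mav : M (a * v) by exact: subalgM.
right; exists (fun i => if unlift ord0 i is Some j then p j else a * v); split.
  by move=> i; case: unliftP.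
move=> i j; case: (unliftP ord0 i) => [i'|] ->; case: (unliftP ord0 j) => [j'|] -> //.
- by rewrite (inj_eq lift_inj); exact: porth.
- by rewrite (M_comm (Mp i') Mav).
Qed.

End Generators.

Lemma minimal_projections : finite_dimensional M ->
  exists N (p : 'I_N -> A), [/\ forall i, minimal_projection (p i),
    forall i j, i != j -> p i * p j = 0 & \sum_i p i = 1].
Proof.
move=> [n [e [M_e e_span]]].
(* A family of [n.+1] orthogonal nonzero projections is linearly independent, as multiplying a
   relation by [p k] shows; the span of [n] elements has no room for it. *)
have [//|[p [pmin porth]]] := minimal_projections_or M_e e_span n.+1.
have [|u u0 uE] := linear_dependence e_span (v := p) (ltnSn n).
  by move=> k; case: (pmin k).
case/eqP: u0; apply/rowP => k; rewrite mxE.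
have := congr1 (fun x => p k * x) uE.
rewrite mulr0 mulr_sumr (bigD1 k) //= big1 ?addr0.
  case: (pmin k) => _ _ pp p0 _; rewrite -scalerAr pp => /eqP.
  by rewrite scaler_eq0 (negPf p0) orbF => /eqP.
by move=> j jk; rewrite -scalerAr porth ?scaler0 // eq_sym.
Qed.

End MinimalProjections.

(** * The conditional expectation *)

Section PositiveSemidefinite.
Variable K : numClosedFieldType.

(** Diagonalize G by a unitary P and take Y to be [sqrt d] times P; the eigenvalues are values of
    the form at conjugated rows of P. *)
Lemma psd_factor n (G : 'M[K]_n) :
  (forall k l, G k l = Num.conj (G l k)) ->
  (forall z : 'I_n -> K, 0 <= \sum_k \sum_l Num.conj (z k) * z l * G k l) ->
  exists Y : 'M[K]_n, forall k l, G k l = \sum_r Num.conj (Y r k) * Y r l.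
Proof.
move=> G_herm G_psd.
have G_normal : G \is normalmx.
  apply: hermitian_normalmx; apply/is_hermitianmxP.
  rewrite expr0 scale1r; apply/matrixP => k l; rewrite !mxE.
  exact: G_herm.
have GE := orthomx_spectralP G_normal.
set P := spectralmx G in GE; set d := spectral_diag G in GE.
have P_unitary : P \is unitarymx := spectral_unitarymx G.
rewrite invmx_unitary // in GE.
have GkE k l : G k l = \sum_r Num.conj (P r k) * d 0 r * P r l.
  rewrite GE mxE; apply: eq_bigr => r _; congr (_ * _).
  by rewrite mul_mx_diag !mxE.
have dE r : d 0 r = (P *m G *m P^t*)%sesqui r r.
  rewrite GE !mulmxA (unitarymxP P_unitary) mul1mx -mulmxA (unitarymxP P_unitary).
  by rewrite mulmx1 mxE eqxx mulr1n.
have d0 r : 0 <= d 0 r.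
  rewrite dE mxE; have := G_psd (fun k => Num.conj (P r k)).
  congr (_ <= _); rewrite exchange_big /=; apply: eq_bigr => l _.
  rewrite !mxE mulr_suml; apply: eq_bigr => k _.
  by rewrite conjCK mulrAC.
exists (\matrix_(r, l) (sqrtC (d 0 r) * P r l)) => k l; rewrite GkE.
apply: eq_bigr => r _; rewrite !mxE rmorphM /=.
have /CrealP -> : sqrtC (d 0 r) \is Num.real by rewrite ger0_real ?sqrtC_ge0.
by rewrite mulrACA -expr2 sqrtCK mulrA [d 0 r * _]mulrC.
Qed.

End PositiveSemidefinite.

(** * The invariant expectation onto M: construction and uniqueness *)

Section ConditionalExpectation.
Variables (R : realType) (A : cstarAlgType R) (M : set A) (phi : A -> R[i]).
Hypothesis M_subalg : unital_cstar_subalgebra M.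
Hypothesis M_comm : commutative_subset M.
Hypothesis phi_state : state_on setT phi.
Hypothesis phi_tracial : forall m a, M m -> phi (m * a) = phi (a * m).
Hypothesis phi_faithful : faithful_on M phi.
Implicit Types (a x m : A).

Let T_subalg := unital_cstar_subalgebraT A.

Lemma phi_linear k a a' : phi (k *: a + a') = k * phi a + phi a'.
Proof. by have [H _ _] := phi_state; exact: H. Qed.

Lemma phi_sum (I : Type) (s : seq I) (P : pred I) (F : I -> A) :
  phi (\sum_(i <- s | P i) F i) = \sum_(i <- s | P i) phi (F i).
Proof.
apply: (big_morph phi) => [x y|]; first exact: (stateD phi_state).
exact: (state0 T_subalg phi_state).
Qed.

Section Projections.
Variables (N : nat) (p : 'I_N -> A).
Hypothesis p_min : forall i, minimal_projection M (p i).
Hypothesis p_orth : forall i j, i != j -> p i * p j = 0.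
Hypothesis p_sum : \sum_i p i = 1.

Let Mp i : M (p i). Proof. by case: (p_min i). Qed.
Let p_sa i : star (p i) = p i. Proof. by case: (p_min i). Qed.
Let pp i : p i * p i = p i. Proof. by case: (p_min i). Qed.

(** On M this is the character by which M acts on [p i], by [coef_eigen]; on the whole algebra it is
    a state extending that character. *)
Definition coef i a := phi (p i * a) / phi (p i).

Definition expectation a := \sum_i coef i a *: p i.

Let pos_p i : pos (p i).
Proof. by exists (p i); rewrite p_sa pp. Qed.

Let phi_p_ge0 i : 0 <= phi (p i).
Proof. exact: (state_pos T_subalg phi_state). Qed.

Let phi_p_neq0 i : phi (p i) != 0.
Proof.
apply/eqP => p0; have [_ _ _ /eqP pn0 _] := p_min i; apply: pn0.
by apply: (phi_faithful (Mp i)); rewrite p_sa pp.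
Qed.

Lemma coef_linear i k a a' : coef i (k *: a + a') = k * coef i a + coef i a'.
Proof.
by rewrite /coef mulrDr -scalerAr phi_linear mulrDl mulrA.
Qed.

Lemma coef_sum i (I : Type) (s : seq I) (P : pred I) (F : I -> A) :
  coef i (\sum_(j <- s | P j) F j) = \sum_(j <- s | P j) coef i (F j).
Proof. by rewrite /coef mulr_sumr phi_sum mulr_suml. Qed.

Lemma coefZ i k a : coef i (k *: a) = k * coef i a.
Proof.
by rewrite /coef -scalerAr (stateZ T_subalg phi_state) // mulrA.
Qed.

Lemma coef_eigen i m : M m -> m * p i = coef i m *: p i.
Proof.
move=> Mm; have [_ _ _ _ /(_ _ Mm)[l lE]] := p_min i.
rewrite /coef (M_comm (Mp i) Mm) lE (stateZ T_subalg phi_state) //.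
by rewrite mulfK.
Qed.

Lemma coefMl i m a : M m -> coef i (m * a) = coef i m * coef i a.
Proof.
move=> Mm; rewrite {1}/coef mulrA (M_comm (Mp i) Mm) coef_eigen //.
by rewrite -scalerAl (stateZ T_subalg phi_state) // mulrA.
Qed.

Lemma coefMr i m a : M m -> coef i (a * m) = coef i m * coef i a.
Proof.
by move=> Mm; rewrite -coefMl // /coef mulrA -phi_tracial // !mulrA (M_comm Mm (Mp i)).
Qed.

(** The trace property replaces [p i * x] by the positive [p i * x * p i]. *)
Lemma coef_ge0 i x : pos x -> 0 <= coef i x.
Proof.
move=> x0; apply: divr_ge0 => //.
rewrite -(pp i) -mulrA phi_tracial // -{1}(p_sa i).
by apply: (state_pos T_subalg phi_state) => //; exact: pos_conj.
Qed.

Lemma coef_star i a : coef i (star a) = Num.conj (coef i a).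
Proof.
rewrite /coef -{1}(p_sa i) -starM (state_star T_subalg phi_state) //.
rewrite -phi_tracial // rmorphM fmorphV /=; congr (_ / _).
by apply/esym/CrealP/ger0_real.
Qed.

Lemma expectation_in a : M (expectation a).
Proof. by apply: subalg_sum => // i _; exact: subalgZ. Qed.

Lemma expectation_id m : M m -> expectation m = m.
Proof.
move=> Mm; rewrite /expectation -[RHS]mulr1 -p_sum mulr_sumr.
by apply: eq_bigr => i _; rewrite coef_eigen.
Qed.

Lemma expectation_linear : linear expectation.
Proof.
move=> k x y; rewrite /expectation scaler_sumr -big_split /=.
by apply: eq_bigr => i _; rewrite coef_linear scalerDl scalerA.
Qed.

Lemma expectation_bimodule m m' a : M m -> M m' ->
  expectation (m * a * m') = m * expectation a * m'.
Proof.
move=> Mm Mm'; rewrite /expectation mulr_sumr mulr_suml.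
apply: eq_bigr => i _; rewrite coefMr // coefMl //.
have := coef_eigen i Mm; have := coef_eigen i Mm'.
move: (coef i m) (coef i m') (coef i a) => cm cm' ca em' em.
rewrite -scalerAr -scalerAl em -scalerAl (M_comm (Mp i) Mm') em' !scalerA.
by congr (_ *: _); ring.
Qed.

Lemma expectation_invariant a : phi (expectation a) = phi a.
Proof.
rewrite phi_sum -[in RHS](mul1r a) -p_sum mulr_suml phi_sum.
apply: eq_bigr => i _; rewrite (stateZ T_subalg phi_state) //.
by rewrite /coef divfK.
Qed.

Lemma expectation_star a : expectation (star a) = star (expectation a).
Proof.
rewrite /expectation star_sum; apply: eq_bigr => i _.
by rewrite starZ p_sa coef_star.
Qed.

Lemma expectation_pos x : pos x -> pos (expectation x).
Proof.
move=> x0; apply: pos_sum => i _; have c0 := coef_ge0 i x0.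
rewrite -(RRe_real (ger0_real c0)); apply: posZ => //.
by rewrite -ler0c RRe_real // ger0_real.
Qed.

(* Kadison's inequality E(a)^* E(a) <= E(a^* a), from E((a - E a)^* (a - E a)) >= 0. *)
Lemma expectation_contractive a : `|expectation a| <= `|a|.
Proof.
rewrite !normE lecR; set y := expectation a.
have My : M y := expectation_in a.
have Msy := subalg_star M_subalg My.
rewrite -(ler_pXn2r (ltn0Sn 1)) ?nnegrE ?nm_ge0 // -nm_starM.
have El := expectation_linear.
apply: pos_nm_le; [exact: sqr_ge0|exact: pos_starM|].
have h1 := expectation_pos (starM_le_nm a).
have h2 := expectation_pos (pos_starM (a - y)).
have := posD h1 h2; congr pos.
rewrite (linmapB El) (linmapZ El) (expectation_id (subalg1 M_subalg)).
(* The factors 1 give the cross terms the shape of [expectation_bimodule]; each is mapped to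
   [star y * y]. *)
have -> : star (a - y) * (a - y) =
    star a * a + star y * y - (star y * a * 1 + 1 * star a * y).
  by rewrite starB; noncomm.
rewrite (linmapB El) !(linmapD El) !expectation_bimodule //; try exact: subalg1.
rewrite expectation_star -/y (expectation_id (subalgM M_subalg Msy My)).
by noncomm.
Qed.

(** Each scalar matrix [coef i (P k l)] factors through some [Y i]. The matrix with entries
    [sum_i Y i r l p i] then factors the image, since orthogonality of the [p i] removes the cross
    terms. *)
Lemma expectation_cp : completely_positive setT M expectation.
Proof.
move=> n P [X [_ PE]].
have PklE k l : P k l = \sum_r star (X r k) * X r l.
  by rewrite PE mxE; apply: eq_bigr => r _; rewrite mxE.
have /choice[Y YP] : forall i, exists Y : 'M[R[i]]_n,
    forall k l, coef i (P k l) = \sum_r Num.conj (Y r k) * Y r l.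
  move=> i; pose G : 'M[R[i]]_n := \matrix_(k, l) coef i (P k l).
  have [||Y YP] := @psd_factor _ n G.
  - move=> k l; rewrite !mxE -coef_star !PklE star_sum; congr coef.
    by apply: eq_bigr => r _; rewrite starM starK.
  (* The quadratic form at [z] is the state [coef i] evaluated at the sum of the
     [star (w r) * w r]. *)
  - move=> z; pose w r := \sum_k z k *: X r k.
    have := @coef_ge0 i (\sum_r star (w r) * w r).
    have -> : \sum_k \sum_l Num.conj (z k) * z l * G k l =
        coef i (\sum_r star (w r) * w r).
      rewrite coef_sum.
      transitivity (\sum_r \sum_k \sum_l
          Num.conj (z k) * z l * coef i (star (X r k) * X r l)).
        rewrite [RHS]exchange_big /=; apply: eq_bigr => k _.
        rewrite [RHS]exchange_big /=; apply: eq_bigr => l _.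
        by rewrite mxE PklE coef_sum mulr_sumr.
      apply: eq_bigr => r _; rewrite /w star_sum mulr_suml coef_sum.
      apply: eq_bigr => k _; rewrite mulr_sumr coef_sum.
      apply: eq_bigr => l _.
      by rewrite starZ -[in RHS]scalerAl -[in RHS]scalerAr !coefZ mulrA.
    by apply; apply: pos_sum => r _; exact: pos_starM.
  by exists Y => k l; rewrite -YP mxE.
exists (\matrix_(r, l) \sum_i Y i r l *: p i); split.
  by move=> r l; rewrite mxE; apply: subalg_sum => // i _; exact: subalgZ.
apply/matrixP => k l; rewrite !mxE /expectation.
transitivity (\sum_r \sum_i (Num.conj (Y i r k) * Y i r l) *: p i).
  rewrite exchange_big /=; apply: eq_bigr => i _.
  by rewrite YP scaler_suml.
apply: eq_bigr => r _; rewrite !mxE star_sum mulr_suml.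
apply: eq_bigr => i _; rewrite mulr_sumr (bigD1 i) //= big1 ?addr0.
  by rewrite starZ p_sa -scalerAl -scalerAr scalerA pp.
move=> j ji; rewrite starZ p_sa -scalerAl -scalerAr p_orth ?scaler0 //.
by rewrite eq_sym.
Qed.

End Projections.

Lemma conditional_expectation_exists : finite_dimensional M ->
  exists E, conditional_expectation M E /\ forall a, phi (E a) = phi a.
Proof.
move=> /(minimal_projections M_subalg M_comm)[N [p [p_min p_orth p_sum]]].
exists (expectation p); split; last exact: expectation_invariant.
split.
- exact: expectation_linear.
- by split; [exact: expectation_in|exact: expectation_id].
- exact: expectation_contractive.
- exact: expectation_cp.
- by move=> m m' a; exact: expectation_bimodule.
Qed.

Lemma conditional_expectation_unique E E' :
  conditional_expectation M E -> (forall a, phi (E a) = phi a) ->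
  conditional_expectation M E' -> (forall a, phi (E' a) = phi a) -> E = E'.
Proof.
have phiE F m a : conditional_expectation M F -> (forall b, phi (F b) = phi b) ->
    M m -> phi (m * F a) = phi (m * a).
  move=> [_ _ _ _ bimod] phiF Mm.
  by rewrite -(phiF (m * a)) -[m * a]mulr1 bimod ?mulr1 //; exact: subalg1.
move=> HE phi_E HE' phi_E'; apply/funext => a.
have [_ [ME _] _ _ _] := HE; have [_ [ME' _] _ _ _] := HE'.
have Md : M (E a - E' a) by exact: subalgB.
have Msd := subalg_star M_subalg Md.
(* For [d = E a - E' a] in M, both halves of [phi (star d * d)] equal [phi (star d * a)]. *)
apply/eqP; rewrite -subr_eq0; apply/eqP; apply: (phi_faithful Md).
rewrite mulrBr (stateB T_subalg phi_state) //.
by rewrite (phiE E) // (phiE E') // subrr.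
Qed.

End ConditionalExpectation.

Theorem proposition8p4 (R : realType) (A : cstarAlgType R)
    (sigma : {linear A -> A}) (C : set A)
    (sigma1 : sigma 1 = 1)
    (sigma_cp : completely_positive setT setT sigma)
    (C_subalg : unital_cstar_subalgebra C)
    (C_stable : forall c, C c -> C (sigma c))
    (C_AF : approximately_finite C)
    (C_comm : commutative_subset C)
    (sigma_mul : forall c a : A, C c -> sigma (c * a) = sigma c * sigma a)
    (mu : A -> R[i])
    (mu_state : state_on C mu)
    (mu_inv : forall c, C c -> mu (sigma c) = mu c) :
  let good_extension (phi : A -> R[i]) :=
    [/\ state_on setT phi,
        forall c, C c -> phi c = mu c,
        forall a : A, phi (sigma a) = phi a
      & forall c a : A, C c -> phi (c * a) = phi (a * c)] in
  (exists phi : A -> R[i], good_extension phi) /\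
  (faithful_on C mu ->
   forall phi : A -> R[i], good_extension phi ->
   forall M : set A, M `<=` C -> unital_cstar_subalgebra M ->
     finite_dimensional M ->
   exists! E : A -> A,
     conditional_expectation M E /\ forall a : A, phi (E a) = phi a).
Proof.
split; first exact: (invariant_extension sigma1 sigma_cp C_subalg C_stable).
move=> mu_faithful phi [phi_state phi_mu _ phi_comm] M MC M_subalg M_fd.
have M_comm : commutative_subset M by move=> x y /MC Cx /MC Cy; exact: C_comm.
have phi_tracial m a : M m -> phi (m * a) = phi (a * m).
  by move=> /MC; exact: phi_comm.
(* On M, which lies in C, [phi] is [mu], so faithfulness is inherited. *)
have phi_faithful : faithful_on M phi.
  move=> x Mx; rewrite phi_mu; first exact: mu_faithful (MC _ Mx).
  by apply: MC; apply: subalgM => //; exact: subalg_star.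
have [E [HE phiE]] := conditional_expectation_exists M_subalg M_comm phi_state
  phi_tracial phi_faithful M_fd.
exists E; split=> // E' [HE' phiE'].
exact: (conditional_expectation_unique M_subalg phi_state phi_faithful).
Qed.
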